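(* Let $2\le k\le n-3$. Then there exists a function $f:\Lambda^k(\mathbb{R}^n)\to\mathbb{R}$ that is ext. one convex but not ext. quasiconvex.
   Context: $\Lambda^k=\Lambda^k(\mathbb{R}^n)$ is the vector space of alternating $k$-linear forms on $\mathbb{R}^n$, $\wedge$ is the exterior product and $d$ the exterior derivative. $W_0^{1,\infty}(\Omega;\Lambda^{k-1})$ is the usual Sobolev space of $(k-1)$-forms with $W^{1,\infty}$ coefficients vanishing on $\partial\Omega$ (i.e. $W^{1,\infty}\cap W^{1,1}_0$). Let $f:\Lambda^k\to\mathbb{R}$. - $f$ is ext. one convex if for every $\xi\in\Lambda^k$, $\alpha\in\Lambda^{k-1}$, $\beta\in\Lambda^1$ the function $t\mapsto f(\xi+t\,\alpha\wedge\beta)$ is convex on $\mathbb{R}$. - $f$ is ext. quasiconvex if $f$ is Borel measurable, locally bounded, and $\int_\Omega f(\xi+d\omega)\ge f(\xi)\operatorname{meas}\Omega$ for every bounded open set $\Omega\subset\mathbb{R}^n$, every $\xi\in\Lambda^k$ and every $\omega\in W_0^{1,\infty}(\Omega;\Lambda^{k-1})$. *)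

(* Defs.v *)
From HB Require Import structures.
From mathcomp Require Import all_boot all_order all_algebra all_fingroup.
From mathcomp Require Import lra.
From mathcomp Require Import all_classical all_reals all_analysis.

Set Implicit Arguments.
Unset Strict Implicit.
Unset Printing Implicit Defensive.

Import Order.TTheory GRing.Theory Num.Theory.
Import numFieldNormedType.Exports.

Local Open Scope classical_set_scope.
Local Open Scope ring_scope.

Section altform.
Context (R : realType) (n : nat).
Local Notation V := 'rV[R]_n.

(* [dfwith v i x] is the family v with its i-th vector replaced by x. *)
Definition multilinear k (w : ('I_k -> V) -> R) :=
  forall (v : 'I_k -> V) (i : 'I_k) (a : R) (x y : V),
    w (dfwith v i (a *: x + y)) = a * w (dfwith v i x) + w (dfwith v i y).

Definition alternating k (w : ('I_k -> V) -> R) :=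
  forall (v : 'I_k -> V) (i j : 'I_k), i != j -> v i = v j -> w v = 0.

Definition altpred k : {pred ('I_k -> V) -> R^o} :=
  mem [set w : ('I_k -> V) -> R^o | multilinear w /\ alternating w].

Record altform k := AltForm {
  altform_val :> ('I_k -> V) -> R^o ;
  altformP : altform_val \in @altpred k }.

HB.instance Definition _ k := [isSub for @altform_val k].
HB.instance Definition _ k := [Choice of altform k by <:].

Lemma altpred_submod k : submod_closed (@altpred k).
Proof.
split; first by rewrite !inE; split=> [v i a x y|//]; rewrite /= mulr0 addr0.
move=> c f g; rewrite !inE => -[mf af] [mg ag]; split=> [v i a x y|v i j ij vij].
  rewrite !fctE/= mf mg !scalerDr /GRing.scale/= !mulrDr !mulrA [c * a]mulrC.
  by rewrite addrACA.
by rewrite !fctE /= (af _ _ _ ij vij) (ag _ _ _ ij vij) scaler0 addr0.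
Qed.

HB.instance Definition _ k :=
  GRing.isSubmodClosed.Build R _ (@altpred k) (@altpred_submod k).
HB.instance Definition _ k := [SubChoice_isSubLmodule of altform k by <:].

Lemma altform_multilinear k (w : altform k) : multilinear w.
Proof. by have := altformP w; rewrite inE => -[]. Qed.

Lemma altform_alternating k (w : altform k) : alternating w.
Proof. by have := altformP w; rewrite inE => -[]. Qed.

Definition basis_vec (i : 'I_n) : V := delta_mx ord0 i.

Definition alt_coef k (w : altform k) (I : {ffun 'I_k -> 'I_n}) : R :=
  w (fun j => basis_vec (I j)).

Lemma altformD k (w1 w2 : altform k) v : (w1 + w2) v = w1 v + w2 v.
Proof. by []. Qed.

Lemma altformZ k (a : R) (w : altform k) v : (a *: w) v = a * w v.
Proof. by []. Qed.

Lemma alt_coef_eq0 k (w : altform k) : (forall I, alt_coef w I = 0) -> w = 0.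
Proof.
move=> w0; apply/val_inj/funext => v.
suff H m : (m <= k)%N -> forall v : 'I_k -> V,
    (forall j : 'I_k, (m <= j)%N -> exists i, v j = basis_vec i) -> w v = 0.
  by apply: (H k) => // j; rewrite leqNgt ltn_ord.
elim: m => [_ {}v vE|m IH mk {}v vE].
  have /choice[g gE] := fun j => vE j (leq0n j).
  rewrite -(w0 (finfun g)) /alt_coef; congr (w _); apply/funext => j.
  by rewrite ffunE.
pose jm := Ordinal mk.
have -> : v = dfwith v jm (v jm).
  by apply/funext => j; case: dfwithP.
have Hadd (r : seq 'I_n) (F : 'I_n -> R) :
    w (dfwith v jm (\sum_(i <- r) F i *: basis_vec i)) = 0.
  elim: r => [|i r IHr].
    rewrite big_nil; have := altform_multilinear w v jm (-1) 0 0.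
    by rewrite scaler0 addr0 mulN1r addNr.
  rewrite big_cons altform_multilinear IHr addr0 (IH (ltnW mk)) ?mulr0//.
  move=> j; case: dfwithP => [_|j' jj' mj]; first by exists i.
  apply: vE; rewrite ltn_neqAle mj andbT; apply: contra_neq jj' => jE.
  exact: val_inj.
by rewrite [X in dfwith v jm X]row_sum_delta; apply: Hadd.
Qed.

(* Lambda^k is finite dimensional, so all norms induce the same topology (and
   hence the same Borel sets and locally bounded functions); we take the l^1 norm
   of the coefficients on basis vectors, over all multi-indices rather than only
   the increasing ones. *)
Definition alt_norm k (w : altform k) : R := \sum_I `|alt_coef w I|.

Lemma alt_normD k (x y : altform k) : alt_norm (x + y) <= alt_norm x + alt_norm y.
Proof. by rewrite -big_split; apply: ler_sum => I _; apply: ler_normD. Qed.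

Lemma alt_normZ k (l : R) (x : altform k) : alt_norm (l *: x) = `|l| * alt_norm x.
Proof. by rewrite mulr_sumr; apply: eq_bigr => I _; rewrite -normrM. Qed.

Lemma alt_norm_eq0 k (x : altform k) : alt_norm x = 0 -> x = 0.
Proof.
move=> /eqP; rewrite psumr_eq0// => /allP x0; apply: alt_coef_eq0 => I.
by apply/eqP; rewrite -normr_eq0; apply: x0; rewrite mem_index_enum.
Qed.

HB.instance Definition _ k := Lmodule_isNormed.Build R (altform k)
  (@alt_normD k) (@alt_normZ k) (@alt_norm_eq0 k).

(* (a /\ b)(v_1, ..., v_(p+q)) = 1/(p! q!) *
     \sum_s sgn(s) a(v_s(1), ..., v_s(p)) b(v_s(p+1), ..., v_s(p+q)),
   the normalisation for which (dx^i /\ dx^j)(e_i, e_j) = 1 when i != j.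
   The degree of the product is a free index r with p + q = r, which avoids
   transports between Lambda^(k-1+1), Lambda^(1+(k-1)) and Lambda^k. *)
Section ext_wedge.
Context (p q r : nat) (e : (p + q = r)%N) (a : altform p) (b : altform q).

Definition ext_wedge_fun (v : 'I_r -> V) : R :=
  (p`! * q`!)%:R^-1 * \sum_(s : 'S_r) (-1) ^+ s *
    (a (fun i => v (s (cast_ord e (lshift q i)))) *
     b (fun j => v (s (cast_ord e (rshift p j))))).

Let dfwith_comp (m : nat) (h : 'I_m -> 'I_r) (v : 'I_r -> V) i0 x :
  injective h -> (fun i => dfwith v (h i0) x (h i)) = dfwith (fun i => v (h i)) i0 x.
Proof.
move=> hi; apply/funext => i; have [->|ii0] := eqVneq i0 i.
  by rewrite !dfwithin.
by rewrite !dfwithout// (inj_eq hi).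
Qed.

Let dfwith_comp_out (m : nat) (h : 'I_m -> 'I_r) (v : 'I_r -> V) k x :
  (forall i, k != h i) -> (fun i => dfwith v k x (h i)) = (fun i => v (h i)).
Proof. by move=> hk; apply/funext => i; rewrite dfwithout. Qed.

Lemma ext_wedge_subproof : ext_wedge_fun \in @altpred r.
Proof.
rewrite inE; split=> [v k c x y|v k l kl vkl]; rewrite /ext_wedge_fun.
  rewrite [c * (_ * _)]mulrCA -mulrDr; congr (_ * _); rewrite mulr_sumr -big_split/=.
  apply: eq_bigr => s _; rewrite [c * (_ * _)]mulrCA -mulrDr; congr (_ * _).
  pose hl i := s (cast_ord e (lshift q i)).
  pose hr j := s (cast_ord e (rshift p j)).
  have hli : injective hl.
    by move=> i j /perm_inj/cast_ord_inj/lshift_inj.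
  have hri : injective hr.
    by move=> i j /perm_inj/cast_ord_inj/rshift_inj.
  have hlr i j : hl i != hr j.
    by rewrite (inj_eq perm_inj) (inj_eq (@cast_ord_inj _ _ e)) eq_lrshift.
  have kE : k = s (cast_ord e (cast_ord (esym e) (s^-1%g k))).
    by rewrite cast_ordKV permKV.
  case: (split_ordP (cast_ord (esym e) (s^-1%g k))) => i iE; rewrite iE in kE.
    rewrite -/(hl i) in kE.
    have E z : (fun i => dfwith v k z (s (cast_ord e (lshift q i)))) =
        dfwith (fun i => v (hl i)) i z by rewrite kE -(dfwith_comp _ _ _ hli).
    have E' z : (fun i => dfwith v k z (s (cast_ord e (rshift p i)))) =
        (fun i => v (hr i)).
      by rewrite kE -(@dfwith_comp_out _ hr v (hl i) z).
    by rewrite !E !E' altform_multilinear mulrDl mulrA.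
  rewrite -/(hr i) in kE.
  have E z : (fun i => dfwith v k z (s (cast_ord e (rshift p i)))) =
      dfwith (fun i => v (hr i)) i z by rewrite kE -(dfwith_comp _ _ _ hri).
  have E' z : (fun i => dfwith v k z (s (cast_ord e (lshift q i)))) =
      (fun i => v (hl i)).
    rewrite kE -(@dfwith_comp_out _ hl v (hr i) z)// => j.
    by rewrite eq_sym.
  by rewrite !E !E' altform_multilinear mulrDr mulrCA.
set S := (X in _ * X); suff -> : S = 0 by rewrite mulr0.
have vt i : v (tperm k l i) = v i by case: tpermP => [->|->|].
apply/eqP; rewrite -oppr_eq0 -[_ == _](@mulrn_eq0 R _ 2) mulr2n addr_eq0.
rewrite opprK eq_sym {1}/S (reindex_inj (mulIg (tperm k l)))/= -sumrN.
apply/eqP/eq_bigr => s _.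
rewrite odd_permM odd_tperm kl addbT signrN mulNr.
congr (- (_ * (a _ * b _))); apply/funext => i; by rewrite permM vt.
Qed.

Definition ext_wedge : altform r := AltForm ext_wedge_subproof.

End ext_wedge.

Definition dx_fun (i : 'I_n) (v : 'I_1 -> V) : R := v ord0 ord0 i.

Lemma dx_subproof i : dx_fun i \in @altpred 1.
Proof.
rewrite inE; split=> [v k c x y|v k l]; last by rewrite !ord1 eqxx.
by rewrite /dx_fun ord1 !dfwithin !mxE.
Qed.

Definition dx i : altform 1 := AltForm (dx_subproof i).

End altform.

(* The product sigma-algebra on R^n, as for tuples in the library; it contains the
   open sets (open_measurable_rV), so it is the Borel sigma-algebra. *)
Section measurable_rV.
Context (R : realType) (n : nat).

Let coor (i : 'I_n) (x : 'rV[R]_n) : measurableTypeR R := x ord0 i.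

Let rV_set0 : g_sigma_preimage coor set0.
Proof. exact: sigma_algebra0. Qed.

Let rV_setC A : g_sigma_preimage coor A -> g_sigma_preimage coor (~` A).
Proof. exact: sigma_algebraC. Qed.

Let rV_bigcup (F : _^nat) : (forall i, g_sigma_preimage coor (F i)) ->
  g_sigma_preimage coor (\bigcup_i (F i)).
Proof. exact: sigma_algebra_bigcup. Qed.

HB.instance Definition _ := @isMeasurable.Build
  (measure_tuple_display default_measure_display) 'rV[R]_n (g_sigma_preimage coor)
  rV_set0 rV_setC rV_bigcup.

End measurable_rV.
Section measurable_fun_rV.
Context (R : realType) (n : nat).

Lemma measurable_coord (i : 'I_n) :
  measurable_fun [set: 'rV[R]_n] (fun x : 'rV[R]_n => x ord0 i).
Proof.
move=> _ Y mY; rewrite setTI; apply: sub_sigma_algebra => /=.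
rewrite -bigcup_seq/=; exists i => /=; first by rewrite mem_index_enum.
by exists Y => //; rewrite setTI.
Qed.

Lemma measurable_fun_rV d (T : measurableType d) (f : T -> 'rV[R]_n) :
  (forall i, measurable_fun [set: T] (fun x => f x ord0 i)) ->
  measurable_fun [set: T] f.
Proof.
move=> mf _ A mA.
suff H : measurable `<=` image_set_system [set: T] f measurable by exact: H.
apply: smallest_sub.
  by apply: sigma_algebra_image; exact: sigma_algebra_measurable.
rewrite -bigcup_seq/=; apply: bigcup_sub => i _ B [C mC <-].
by rewrite /image_set_system/= !setTI; have := mf i measurableT C mC; rewrite setTI.
Qed.
End measurable_fun_rV.

(* Lebesgue measure on R^n by iterated products; lebesgue_rV_box gives its value on
   boxes. *)
Section lebesgue_rV.
Context (R : realType).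

Definition consrV n (x : measurableTypeR R * 'rV[R]_n) : 'rV[R]_(1 + n) :=
  row_mx (x.1%:M : 'rV_1) x.2.

Definition unconsrV n (y : 'rV[R]_(1 + n)) : measurableTypeR R * 'rV[R]_n :=
  (y ord0 ord0, rsubmx y).

Lemma consrV0 n x : (@consrV n x : 'rV[R]_n.+1) ord0 ord0 = x.1.
Proof.
transitivity (@consrV n x ord0 (lshift n (ord0 : 'I_1))).
  by congr (_ _ _); exact: val_inj.
by rewrite row_mxEl mxE eqxx mulr1n.
Qed.

Lemma consrVS n x i : (@consrV n x : 'rV[R]_n.+1) ord0 (lift ord0 i) = x.2 ord0 i.
Proof.
transitivity (@consrV n x ord0 (rshift 1 i)).
  by congr (_ _ _); exact: val_inj.
by rewrite row_mxEr.
Qed.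

Lemma consrVK n : cancel (@consrV n) (@unconsrV n).
Proof.
case=> x v; rewrite /consrV /unconsrV row_mxKr; congr pair => /=.
rewrite (_ : ord0 = lshift n (ord0 : 'I_1)) ?row_mxEl ?mxE//.
exact: val_inj.
Qed.

Lemma unconsrVK n : cancel (@unconsrV n) (@consrV n).
Proof.
move=> y; pose z : 'rV_(1 + n) := y.
transitivity (@row_mx R 1 1 n (lsubmx z) (rsubmx z)); last first.
  exact: (@hsubmxK R 1 1 n z).
rewrite /consrV /unconsrV/=; congr (@row_mx _ 1 1 n _ _).
by apply/rowP => i; rewrite !ord1 !mxE/= mulr1n; congr (y _ _); exact: val_inj.
Qed.

Lemma measurable_consrV n : measurable_fun setT (@consrV n).
Proof.
apply: measurable_fun_rV => i; rewrite /consrV.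
case: (@split_ordP 1 n i) => j ->.
  by under eq_fun do rewrite row_mxEl mxE (ord1 j) eqxx mulr1n; exact: measurable_fst.
under eq_fun do rewrite row_mxEr.
exact: (measurableT_comp (measurable_coord j) measurable_snd).
Qed.

Lemma measurable_unconsrV n : measurable_fun setT (@unconsrV n).
Proof.
apply/measurable_fun_pairP; split; first exact: measurable_coord.
apply: measurable_fun_rV => i; rewrite /=.
by under eq_fun do rewrite mxE; exact: measurable_coord.
Qed.

Section step.
Context (n : nat) (mu : {sigma_finite_measure set 'rV[R]_n -> \bar R}).

Definition lebesgue_cons : set 'rV[R]_n.+1 -> \bar R :=
  pushforward (lebesgue_measure \x mu)%E (@consrV n).

Let lebesgue_cons0 : lebesgue_cons set0 = 0%E.
Proof. by rewrite /lebesgue_cons /pushforward preimage_set0 measure0. Qed.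

Let lebesgue_cons_ge0 A : (0 <= lebesgue_cons A)%E.
Proof. by rewrite /lebesgue_cons /pushforward measure_ge0. Qed.

Let lebesgue_cons_sigma_additive : semi_sigma_additive lebesgue_cons.
Proof.
move=> F mF tF mUF; rewrite /lebesgue_cons /pushforward preimage_bigcup.
apply: measure_semi_sigma_additive.
- by move=> i; rewrite -[X in measurable X]setTI; exact: measurable_consrV.
- apply/trivIsetP => /= i j _ _ ij; rewrite -preimage_setI.
  by move/trivIsetP : tF => /(_ _ _ _ _ ij) ->//; rewrite preimage_set0.
- by rewrite -preimage_bigcup -[X in measurable X]setTI; exact: measurable_consrV.
Qed.

HB.instance Definition _ := isMeasure.Build _ _ _
  lebesgue_cons lebesgue_cons0 lebesgue_cons_ge0 lebesgue_cons_sigma_additive.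

Let lebesgue_cons_sigma_finite : sigma_finite setT lebesgue_cons.
Proof.
have /sigma_finiteP[F [FT ndF mF]] := sigma_finiteT (@lebesgue_measure R).
have /sigma_finiteP[G [GT ndG mG]] := sigma_finiteT mu.
exists (fun i => @unconsrV n @^-1` (F i `*` G i)) => [|i].
  apply/esym; rewrite -subTset => y _.
  have : [set: R] (unconsrV y).1 by [].
  rewrite FT => -[i _ Fi].
  have : [set: 'rV[R]_n] (unconsrV y).2 by [].
  rewrite GT => -[j _ Gj]; exists (maxn i j) => //; split.
    by move: Fi; apply/subsetPset/ndF/leq_maxl.
  by move: Gj; apply/subsetPset/ndG/leq_maxr.
have [mFi Fi] := mF i; have [mGi Gi] := mG i; split.
  rewrite -[X in measurable X]setTI; apply: measurable_unconsrV => //.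
  exact: measurableX.
rewrite /lebesgue_cons /pushforward -comp_preimage.
rewrite (_ : @unconsrV n \o _ = id); last by apply/funext => x /=; rewrite consrVK.
by rewrite product_measure1E// lte_mul_pinfty// ge0_fin_numE.
Qed.

HB.instance Definition _ := Measure_isSigmaFinite.Build _ _ _ lebesgue_cons
  lebesgue_cons_sigma_finite.

End step.

Fixpoint lebesgue_rV n : {sigma_finite_measure set 'rV[R]_n -> \bar R} :=
  match n with
  | 0 => \d_(0 : 'rV[R]_0)
  | m.+1 => lebesgue_cons (lebesgue_rV m)
  end.

End lebesgue_rV.

Lemma measurable_box (R : realType) n (A : 'I_n -> set R) :
  (forall i, measurable (A i)) ->
  measurable [set x : 'rV[R]_n | forall i, A i (x ord0 i)].
Proof.
move=> mA; rewrite (_ : [set _ | _] =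
    \big[setI/setT]_(i < n) ((fun x : 'rV[R]_n => x ord0 i) @^-1` A i)).
  apply: bigsetI_measurable => i _.
  by have := measurable_coord i measurableT (mA i); rewrite setTI.
rewrite -bigcap_seq; apply/seteqP; split => x /= Ax i; first by move=> _; exact: Ax.
by apply: Ax => /=; exact: mem_index_enum.
Qed.

Lemma lebesgue_rV_box (R : realType) n (A : 'I_n -> set R) :
  (forall i, measurable (A i)) ->
  lebesgue_rV R n [set x : 'rV[R]_n | forall i, A i (x ord0 i)] =
  (\prod_(i < n) lebesgue_measure (A i))%E.
Proof.
elim: n A => [|n IH] A mA.
  by rewrite big_ord0 /= diracE mem_set// => -[].
rewrite big_ord_recl -IH//.
rewrite -[LHS]/(lebesgue_cons (lebesgue_rV R n) _) /lebesgue_cons /pushforward.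
rewrite -product_measure1E//; last first.
  by apply: (@measurable_box R n (fun i => A (lift ord0 i))) => i; exact: mA.
  exact: mA.
suff -> : @consrV R n @^-1` [set x : 'rV[R]_n.+1 | forall i, A i (x ord0 i)] =
  A ord0 `*` [set x : 'rV[R]_n | forall i, A (lift ord0 i) (x ord0 i)] by [].
apply/seteqP; split => -[x v] /=.
  move=> Ax; split => [|i]; first by have := Ax ord0; rewrite consrV0.
  by have := Ax (lift ord0 i); rewrite consrVS.
move=> [A0 Av] i; case: (unliftP ord0 i) => [j|] ->; last by rewrite consrV0.
by rewrite consrVS; exact: Av.
Qed.

Lemma open_measurable_rV (R : realType) n (U : set 'rV[R]_n) :
  open U -> measurable U.
Proof.
move=> oU.
pose B (c : 'rV[rat]_n * rat) : set 'rV[R]_n := [set x | forall i,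
  `](ratr (c.1 ord0 i) - ratr c.2), (ratr (c.1 ord0 i) + ratr c.2)[%classic (x ord0 i)].
have mB c : measurable (B c).
  by apply: (@measurable_box R n (fun i => _)) => i; exact: measurable_itv.
rewrite (_ : U = \bigcup_(c in [set c | B c `<=` U]) B c); last first.
  apply/seteqP; split => [x Ux|x [c /= cU] /cU//].
  have /nbhs_ballP[e /= e0 eU] := open_nbhs_nbhs (conj oU Ux).
  have [r] := @rat_in_itvoo R 0 (e / 2) ltac:(by rewrite divr_gt0).
  rewrite in_itv/= => /andP[r0 re].
  have /choice[q qP] i : exists q : rat, ratr q \in `](x ord0 i - ratr r), (x ord0 i + ratr r)[.
    by apply: rat_in_itvoo; rewrite ltrBlDr -addrA ltrDl addr_gt0.
  exists (\row_i q i, r); last first.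
    move=> i /=; rewrite mxE in_itv/=; have := qP i; rewrite in_itv/= => /andP[q1 q2].
    by rewrite ltrBlDr q2/= -ltrBlDr q1.
  move=> y By; apply: eU; split => // i j; rewrite (ord1 i).
  have := By j; rewrite /= mxE in_itv/= => /andP[y1 y2].
  have := qP j; rewrite in_itv/= => /andP[q1 q2].
  rewrite /ball/= ltr_norml; apply/andP; split; lra.
rewrite bigcup_mkcond; apply: countable_bigcupT_measurable => // c.
by case: ifPn.
Qed.

Section sobolev.
Context (R : realType) (n : nat).
Local Notation V := 'rV[R]_n.
Local Notation vol := (lebesgue_rV R n).
Implicit Types (Omega : set V) (u phi : V -> R) (Du : 'I_n -> V -> R).

Definition partial (i : 'I_n) (u : V -> R) : V -> R :=
  fun x => 'D_(basis_vec R i) u x.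

(* All iterated partial derivatives exist and are continuous. *)
Definition smooth (u : V -> R) := forall s : seq 'I_n,
  let v := foldr partial u s in
  continuous v /\ forall i x, derivable v x (basis_vec R i).

(* C_c^oo(Omega), each function being extended by 0 to R^n. *)
Definition test_fun Omega phi :=
  [/\ smooth phi, compact (closure [set x | phi x != 0]) &
      closure [set x | phi x != 0] `<=` Omega].

(* Sobolev spaces are given as relations between a function and its weak partial
   derivatives, the latter being determined only almost everywhere. *)
Definition weak_gradient Omega u Du := forall phi, test_fun Omega phi ->
  forall i, (\int[vol]_(x in Omega) (u x * partial i phi x)%:E =
           - \int[vol]_(x in Omega) (Du i x * phi x)%:E)%E.

Definition W1 (p : \bar R) Omega u Du :=
  [/\ u \_ Omega \in Lfun vol p,
      forall i, Du i \_ Omega \in Lfun vol p &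
      weak_gradient Omega u Du].

(* W_0^{1,1}: the closure of C_c^oo(Omega) in W^{1,1}(Omega). *)
Definition W1_0_1 Omega u Du := W1 1%E Omega u Du /\
  exists phi : nat -> V -> R, [/\ forall j, test_fun Omega (phi j),
    (fun j => \int[vol]_(x in Omega) `|phi j x - u x|%:E)%E @ \oo --> 0%E &
    forall i, (fun j => \int[vol]_(x in Omega)
      `|partial i (phi j) x - Du i x|%:E)%E @ \oo --> 0%E].

(* W_0^{1,oo} = W^{1,oo} `&` W_0^{1,1}. *)
Definition W1_0_oo Omega u Du := W1 +oo%E Omega u Du /\ W1_0_1 Omega u Du.

Definition W1_0_oo_form p Omega (w : V -> altform R n p)
    (Dw : 'I_n -> V -> altform R n p) := forall I : {ffun 'I_p -> 'I_n},
  W1_0_oo Omega (fun x => alt_coef (w x) I) (fun i x => alt_coef (Dw i x) I).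

(* d w = \sum_i dx^i /\ (D_i w), from the weak partial derivatives Dw of w. *)
Definition ext_d p k (e : (1 + p = k)%N) (Dw : 'I_n -> V -> altform R n p)
    (x : V) : altform R n k :=
  \sum_(i < n) ext_wedge e (dx R i) (Dw i x).

End sobolev.

Section convexity.
Context (R : realType) (n k : nat).
Implicit Types f : altform R n k -> R.

(* The equation e forces p = k - 1. *)
Definition ext_one_convex f :=
  forall p (e : (p + 1 = k)%N) (xi : altform R n k)
    (alpha : altform R n p) (beta : altform R n 1),
  convex_function [set: R^o] (fun t : R^o => f (xi + t *: ext_wedge e alpha beta)).

Definition borel_measurable f := measurable_fun
  [set: g_sigma_algebraType (@open (altform R n k))] (f : _ -> measurableTypeR R).

Definition locally_bounded f := forall xi : altform R n k,
  bounded_near (f : _ -> R^o) (nbhs xi).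

Definition ext_quasiconvex f :=
  [/\ borel_measurable f, locally_bounded f &
    forall p (e : (1 + p = k)%N) (Omega : set 'rV[R]_n) (xi : altform R n k)
      (w : 'rV[R]_n -> altform R n p) (Dw : 'I_n -> 'rV[R]_n -> altform R n p),
    open Omega -> bounded_set Omega -> W1_0_oo_form Omega w Dw ->
    ((f xi)%:E * lebesgue_rV R n Omega <=
     \int[lebesgue_rV R n]_(x in Omega) (f (xi + ext_d e Dw x))%:E)%E].

End convexity.

(* Main.v *)
Require Import Defs.
From HB Require Import structures.
From mathcomp Require Import all_boot all_order all_algebra all_fingroup.
From mathcomp Require Import ring lra zify.
From mathcomp Require Import all_classical all_reals all_analysis.
From mathcomp Require Import measurable_realfun ess_sup_inf.

(** Sverak's example, transported to forms. Let p and q be two coordinates. In k + 1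
    further coordinates, arranged in a cycle, let E_i be the (k-1)-monomial missing the
    two ends of the i-th edge, and let A, C be the sums of the E_i over the odd and even
    edges and B the monomial of the closing edge. In the three-dimensional space of forms
    r dx^p /\ A + s dx^q /\ B + t (dx^p + dx^q) /\ C, only multiples of the three
    generators are divisible by a covector: if beta /\ xi = 0, then following the cycle
    shows that, for each coordinate of beta, two of its products with r, s, t vanish.
    The argument is linear, hence stable: for a form eta = alpha /\ beta at distance d
    from that space, two of r, s, t are O(d). Therefore
      f = - r s t + eps |xi|^4 + gam dist(xi)^2
    is convex along t |-> xi + t eta once gam >= const / eps.
    On the other hand, for the potential
      N^-1 chi (sin(N x_p) A + sin(N x_q) B + sin(N (x_p + x_q)) C)
    with chi a cutoff, r s t equals chi^3 cos a cos b cos(a + b) up to O(1/N), whose mean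
    tends to that of chi^3 / 4 > 0; so the integral of f becomes negative when eps is
    small and then N large, although f(0) = 0. *)

Set Implicit Arguments.
Unset Strict Implicit.
Unset Printing Implicit Defensive.

Import Order.TTheory GRing.Theory Num.Theory.
Import numFieldNormedType.Exports.

Local Open Scope classical_set_scope.
Local Open Scope ring_scope.

(** * Forms divisible by a covector *)

Section alternating_forms.
Context (R : realType) (n : nat).
Local Notation V := 'rV[R]_n.

Lemma altform_ext k (w1 w2 : altform R n k) : (forall v, w1 v = w2 v) -> w1 = w2.
Proof. by move=> h; apply/val_inj/funext. Qed.

Lemma altformDl k (w : altform R n k) (v : 'I_k -> V) i x y :
  w (dfwith v i (x + y)) = w (dfwith v i x) + w (dfwith v i y).
Proof.
by have := altform_multilinear w v i 1 x y; rewrite scale1r mul1r.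
Qed.

Lemma dfwith_swap (T : Type) k (v : 'I_k -> T) i j x y : i != j ->
  dfwith (dfwith v i x) j y = dfwith (dfwith v j y) i x.
Proof.
move=> ij; apply/funext => l.
have [<-|jl] := eqVneq j l; first by rewrite dfwithin dfwithout ?dfwithin.
rewrite (dfwithout _ _ jl).
have [<-|il] := eqVneq i l; first by rewrite !dfwithin.
by rewrite !dfwithout.
Qed.

Lemma dfwith_id (T : Type) k (v : 'I_k -> T) i : dfwith v i (v i) = v.
Proof. by apply/funext => j; case: dfwithP. Qed.

Lemma altform_eq0_dfwith2 k (w : altform R n k) (v : 'I_k -> V) i j x : i != j ->
  w (dfwith (dfwith v i x) j x) = 0.
Proof.
move=> ij; apply: (altform_alternating w ij).
by rewrite dfwithin dfwithout 1?eq_sym// dfwithin.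
Qed.

(** Polarisation: expand the vanishing value of [w] with [v i + v j] in both slots. *)
Lemma altform_tperm k (w : altform R n k) (v : 'I_k -> V) i j : i != j ->
  w (fun l => v (tperm i j l)) = - w v.
Proof.
move=> ij; have := altform_eq0_dfwith2 w v (v i + v j) ij.
rewrite altformDl (dfwith_swap _ (v i + v j) _ ij) altformDl.
rewrite (dfwith_swap _ (v i + v j) (v j) ij) altformDl.
rewrite -!(dfwith_swap _ _ _ ij) !altform_eq0_dfwith2// add0r addr0.
have -> : dfwith (dfwith v i (v j)) j (v i) = fun l => v (tperm i j l).
  apply/funext => l; case: tpermP => [->|->|/eqP li /eqP lj].
  - by rewrite dfwithout 1?eq_sym// dfwithin.
  - by rewrite dfwithin.
  - by rewrite !dfwithout// eq_sym.
by rewrite !dfwith_id => /eqP; rewrite addr_eq0 => /eqP.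
Qed.

Lemma altform_perm k (w : altform R n k) v (s : 'S_k) :
  w (fun i => v (s i)) = (-1) ^+ s * w v.
Proof.
have [ts -> dts] := prod_tpermP s.
elim: ts dts v => [_|t ts IH /= /andP[dt dts]] v.
  rewrite big_nil odd_perm1 mul1r; congr (w _); apply/funext => i.
  by rewrite perm1.
rewrite big_cons odd_permM odd_tperm dt addTb signrN mulNr -IH//.
have := altform_tperm w
  (fun i => v ((\prod_(t0 <- ts) tperm t0.1 t0.2)%g i)) dt.
by move=> <-; congr (w _); apply/funext => i; rewrite permM.
Qed.

(* Vanishing on tuples from ker b is the only consequence of divisibility by b that
   the argument needs. *)
Lemma wedge_ker_eq0 p k (e : (p + 1 = k)%N) (a : altform R n p)
    (b : altform R n 1) (v : 'I_k -> V) :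
  (forall i, b (fun=> v i) = 0) -> ext_wedge e a b v = 0.
Proof.
move=> bv; rewrite /ext_wedge/= /ext_wedge_fun big1 ?mulr0// => s _.
suff -> : b (fun j => v (s (cast_ord e (rshift p j)))) = 0 by rewrite !mulr0.
rewrite -[RHS](bv (s (cast_ord e (rshift p ord0)))); congr (b _).
by apply/funext => j; rewrite ord1.
Qed.

(** The equation b /\ w = 0 evaluated at (v0, v_1, ..., v_k). Moving [v0] into the slot of the
    removed vector absorbs all signs. *)
Definition exchange_rel k (w : altform R n k) (b : V -> R) v0 (v : 'I_k -> V) :=
  b v0 * w v = \sum_i b (v i) * w (dfwith v i v0).

(** Induction on the number of leading slots allowed to lie outside ker b. An entry outside the
    kernel is split into a multiple of [v0] and a kernel vector, which needs division by [b v0]. *)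
Lemma exchange_neq0 k (w : altform R n k) (b : {scalar V}) v0 v :
  (forall v, (forall i, b (v i) = 0) -> w v = 0) -> b v0 != 0 ->
  exchange_rel w b v0 v.
Proof.
move=> wker bv0; rewrite /exchange_rel.
suff H m : (m <= k)%N -> forall v, (forall j : 'I_k, (m <= j)%N -> b (v j) = 0) ->
    b v0 * w v = \sum_i b (v i) * w (dfwith v i v0).
  by apply: (H k) => // j; rewrite leqNgt ltn_ord.
elim: m => [_|m IH mk] {}v vE.
  rewrite wker ?mulr0 => [|i]; last exact: vE.
  by rewrite big1// => i _; rewrite vE ?mul0r.
pose j := Ordinal mk; pose c := b (v j) / b v0; pose u := v j - c *: v0.
have bu : b u = 0 by rewrite linearB linearZ/= divfK// subrr.
have vj : v j = c *: v0 + u by rewrite addrC subrK.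
have wv : w v = c * w (dfwith v j v0) + w (dfwith v j u).
  by rewrite -{1}(dfwith_id v j) vj altform_multilinear.
rewrite wv mulrDr IH; last 2 first.
- exact: ltnW.
- move=> i mi; have [<-|ji] := eqVneq j i; first by rewrite dfwithin.
  rewrite dfwithout// vE// ltn_neqAle mi andbT; apply: contra_neq ji => ji.
  exact: val_inj.
rewrite (bigD1 j)//= dfwithin bu mul0r add0r [RHS](bigD1 j)//=.
congr (_ + _); first by rewrite mulrA /c mulrCA divff// mulr1.
(* For i != j, slot [j] may hold [u] instead of [v j]: they differ by a multiple of [v0], which
   already sits in slot [i]. *)
apply: eq_bigr => i ij; rewrite dfwithout 1?eq_sym//; congr (_ * _).
rewrite dfwith_swap 1?eq_sym// /u -scaleNr addrC.
rewrite altform_multilinear altform_eq0_dfwith2// mulr0 add0r.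
have <- : dfwith v i v0 j = v j by rewrite dfwithout.
by rewrite dfwith_id.
Qed.

(** Both sides are additive in [v0]. When [b v0 = 0], the relation for some [x] with [b x != 0] is
    subtracted from the one for [v0 + x]. *)
Lemma exchange k (w : altform R n k) (b : {scalar V}) v0 v :
  (forall v, (forall i, b (v i) = 0) -> w v = 0) -> exchange_rel w b v0 v.
Proof.
move=> wker; have [b0|] := eqVneq (b v0) 0; last exact: exchange_neq0.
have [[x bx]|b00] := pselect (exists x, b x != 0); last first.
  have {}b00 x : b x = 0.
    by apply/eqP; apply: contra_notT b00 => bx; exists x.
  by rewrite /exchange_rel b00 mul0r big1// => i _; rewrite b00 mul0r.
have bx0 : b (v0 + x) != 0 by rewrite linearD/= b0 add0r.
have := exchange_neq0 v wker bx0; have := exchange_neq0 v wker bx.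
rewrite /exchange_rel linearD/= mulrDl => ->.
under [in X in _ = X -> _]eq_bigr do rewrite altformDl mulrDr.
by rewrite big_split/= => /addIr.
Qed.

Definition form1 (b : altform R n 1) (v : V) : R := b (fun=> v).

Lemma form1_scalar (b : altform R n 1) : scalar (form1 b).
Proof.
move=> a x y; pose o : 'I_1 -> V := fun=> 0; have E z : (fun=> z) = dfwith o ord0 z.
  by apply/funext => i; case: dfwithP => // j; rewrite !ord1 eqxx.
by rewrite /form1 !E altform_multilinear.
Qed.
HB.instance Definition _ (b : altform R n 1) := GRing.isLinear.Build R V R *%R
  (form1 b) (form1_scalar b).

End alternating_forms.

(** * Monomials and their coefficients *)

Section minors.
Context (R : realType) (n : nat).
Local Notation V := 'rV[R]_n.

(** Permutations are grouped by their value [j] at 0. Each class is a copy of S_q, whose q! equal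
    terms cancel the normalisation, leaving a cofactor expansion. *)
Lemma wedge_dxE q (i : 'I_n) (b : altform R n q) (e : (1 + q = q.+1)%N)
    (v : 'I_q.+1 -> V) :
  ext_wedge e (dx R i) b v =
  \sum_(j < q.+1) (-1) ^+ j * (v j ord0 i * b (fun l => v (lift j l))).
Proof.
rewrite /ext_wedge/= /ext_wedge_fun (_ : 1`! = 1)%N// mul1n.
pose P (s : 'S_q.+1) := s ord0.
rewrite (partition_big P xpredT)//= mulr_sumr; apply: eq_bigr => j _.
rewrite (reindex (lift_perm ord0 j)) /=; last first.
  (* The inverse of [lift_perm] deletes 0 and its image [s ord0] and renumbers what is left. *)
  pose del (s : 'S_q.+1) l := odflt l (unlift (s ord0) (s (lift ord0 l))).
  have delK (s : 'S_q.+1) l : lift (s ord0) (del s l) = s (lift ord0 l).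
    rewrite /del; have := neq_lift ord0 l.
    by rewrite -(inj_eq (@perm_inj _ s)) => /unlift_some[? ? ->].
  have del_inj (s : 'S_q.+1) : injective (del s).
    by move=> l l' /(congr1 (lift (s ord0))); rewrite !delK => /perm_inj/lift_inj.
  exists (fun s => perm (del_inj s)) => [s _|s /eqP <-]; apply/permP => l.
    apply: (@lift_inj _ j); have := delK (lift_perm ord0 j s) l.
    by rewrite lift_perm_id lift_perm_lift permE.
  case: (unliftP ord0 l) => [l'|] ->; last by rewrite lift_perm_id.
  by rewrite lift_perm_lift permE delK.
rewrite (eq_bigl xpredT); last by move=> s; rewrite /P lift_perm_id eqxx.
rewrite (eq_bigr (fun=> (-1) ^+ j * (v j ord0 i * b (fun l => v (lift j l))))).
  by rewrite sumr_const card_Sn -[X in _ * X]mulr_natl mulKf//.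
move=> s _; rewrite odd_lift_perm addFb signr_addb signr_odd -mulrA; congr (_ * _).
rewrite /dx_fun mulrCA; congr (_ * _).
  congr (v _ _ _); rewrite -[RHS](lift_perm_id ord0 j s); congr (lift_perm _ _ _ _).
  exact: val_inj.
have -> : (fun l => v (lift_perm ord0 j s (cast_ord e (rshift 1 l)))) =
    (fun l => v (lift j (s l))).
  apply/funext => l; rewrite -(lift_perm_lift ord0 j s); congr (v (lift_perm _ _ _ _)).
  exact: val_inj.
by rewrite (altform_perm b (fun l => v (lift j l))) signrMK.
Qed.


(** The monomial dx^(J 0) /\ ... /\ dx^(J (q-1)). *)
Definition minor_fun q (J : 'I_q -> 'I_n) (v : 'I_q -> V) : R :=
  \det (\matrix_(a, b) v a ord0 (J b)).

Lemma minor_subproof q (J : 'I_q -> 'I_n) : minor_fun J \in @altpred R n q.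
Proof.
rewrite inE; split=> [v i a x y|v i j ij vij]; rewrite /minor_fun.
  rewrite -[in RHS](mul1r (\det (\matrix_(_, _) dfwith v i y _ _ _))).
  apply: (determinant_multilinear (i0 := i)).
  - by apply/rowP => b; rewrite !mxE !dfwithin !mxE mul1r.
  - by apply/matrixP => c b; rewrite !mxE !dfwithout ?neq_lift.
  - by apply/matrixP => c b; rewrite !mxE !dfwithout ?neq_lift.
by apply: (determinant_alternate ij) => b; rewrite !mxE vij.
Qed.

Definition minor q (J : 'I_q -> 'I_n) : altform R n q := AltForm (minor_subproof J).

(** Like [alt_coef], but on plain index functions, so that [dfwith] acts on indices directly. *)
Definition coef k (w : altform R n k) (I : 'I_k -> 'I_n) : R :=
  w (fun j => basis_vec R (I j)).
Arguments coef : simpl never.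

Lemma coefE k (w : altform R n k) I : coef w I = alt_coef w (finfun I).
Proof. by rewrite /coef /alt_coef; congr (w _); apply/funext => j; rewrite ffunE. Qed.

Lemma minor_eq0 q (J I : 'I_q -> 'I_n) a :
  (forall b, I a != J b) -> coef (minor J) I = 0.
Proof.
move=> IJ; rewrite /coef/= /minor_fun (expand_det_row _ a) big1// => b _.
by rewrite !mxE [J b == _]eq_sym (negPf (IJ b)) andbF mul0r.
Qed.

Lemma minor_perm q (J : 'I_q -> 'I_n) (s : 'S_q) : injective J ->
  coef (minor J) (fun a => J (s a)) = (-1) ^+ s.
Proof.
move=> Ji; rewrite /coef/= /minor_fun -det_perm; congr (\det _).
by apply/matrixP => a b; rewrite !mxE/= eq_sym (inj_eq Ji).
Qed.

Lemma minor_id q (J : 'I_q -> 'I_n) : injective J -> coef (minor J) J = 1.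
Proof.
move=> Ji; transitivity (coef (minor J) (fun a => J ((1 : 'S_q)%g a))).
  by congr (coef _ _); apply/funext => i; rewrite perm1.
by rewrite minor_perm// odd_perm1.
Qed.

Lemma coef_sum k (I : 'I_k -> 'I_n) T (r : seq T) (F : T -> altform R n k) :
  coef (\sum_(t <- r) F t) I = \sum_(t <- r) coef (F t) I.
Proof. by elim: r => [|t r IH]; rewrite ?big_nil// !big_cons -IH. Qed.

Lemma coefD k (w w' : altform R n k) I : coef (w + w') I = coef w I + coef w' I.
Proof. by []. Qed.

Lemma coefN k (w : altform R n k) I : coef (- w) I = - coef w I.
Proof. by []. Qed.

Lemma coefZ k c (w : altform R n k) I : coef (c *: w) I = c * coef w I.
Proof. by []. Qed.

Lemma coef_wedge_dx q (i : 'I_n) (b : altform R n q) (e : (1 + q = q.+1)%N)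
    (I : 'I_q.+1 -> 'I_n) :
  coef (ext_wedge e (dx R i) b) I =
  \sum_(j < q.+1) (-1) ^+ j * ((i == I j)%:R * coef b (fun l => I (lift j l))).
Proof.
rewrite /coef wedge_dxE; apply: eq_bigr => j _; congr (_ * (_ * _)).
by rewrite mxE eqxx.
Qed.

End minors.
Arguments coef : simpl never.

(** * Cyclic families of monomials *)

Section cyclic_family.
Context (R : realType) (n' q : nat).
Hypotheses (hq : (0 < q)%N) (hn : (q.+3 <= n')%N).
Local Notation n := n'.+1.

(** Here [q] is k - 1. Coordinates 0 and 1 ([x0] and [x1]) are the two coordinates off the cycle,
    called p and q in the overview; the cycle of length [q.+2] occupies 2, ..., q + 3 and is indexed
    modulo [q.+2]. *)
Definition crd j : 'I_n := inord (j %% q.+2).+2.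
Definition x0 : 'I_n := ord0.
Definition x1 : 'I_n := inord 1.
Definition cyclic (c : 'I_n) := (1 < c < q.+4)%N.

Lemma crdE j : crd j = (j %% q.+2).+2 :> nat.
Proof. by rewrite inordK// ltnS (leq_trans _ hn)// !ltnS -ltnS ltn_pmod. Qed.

Lemma x1E : x1 = 1%N :> nat.
Proof. by rewrite inordK// ltnS (leq_trans _ hn). Qed.

Lemma crd_eq i j : (crd i == crd j) = (i == j %[mod q.+2]).
Proof. by rewrite -val_eqE/= !crdE !eqSS. Qed.

Lemma cyclic_crd j : cyclic (crd j).
Proof. by rewrite /cyclic crdE/= !ltnS -ltnS ltn_pmod. Qed.

Lemma cyclic_x1 : cyclic x1 = false. Proof. by rewrite /cyclic x1E. Qed.

Lemma x1_neq0 : (x1 == x0) = false. Proof. by rewrite -val_eqE/= x1E. Qed.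

Lemma cyclicP c : cyclic c -> exists2 j, (j < q.+2)%N & c = crd j.
Proof.
move=> /andP[c1 c2]; exists (c - 2)%N; first by lia.
by apply/val_inj; rewrite /= crdE modn_small; lia.
Qed.

(* The edge {i, i+1} of the cycle on q+2 vertices is encoded by the monomial of degree
   q in the complementary vertices i+2, ..., i+q+1. *)
Definition arc i (b : 'I_q) := crd (i + b).+2.

Definition edge i : altform R n q := minor R (arc i).

Lemma arc_inj i : injective (arc i).
Proof.
move=> a b /eqP; rewrite crd_eq -!addnS eqn_modDl !modn_small.
- by rewrite !eqSS => /eqP/val_inj.
- by rewrite !ltnS.
- by rewrite !ltnS.
Qed.

Lemma edge_mod i : edge (i %% q.+2) = edge i.
Proof.
congr (minor _ _); apply/funext => b; apply/eqP.
by rewrite crd_eq -!addnS modnDml.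
Qed.

Lemma edge_notin i I a : ~~ cyclic (I a) -> coef (edge i) I = 0.
Proof.
move=> Ia; apply: (@minor_eq0 _ _ _ _ _ a) => b.
by apply: contraNneq Ia => ->; exact: cyclic_crd.
Qed.

Lemma edge_end i I a : I a = crd i \/ I a = crd i.+1 -> coef (edge i) I = 0.
Proof.
have H c : (c < 2)%N -> I a = crd (i + c) -> coef (edge i) I = 0.
  move=> c2 Ia; apply: (@minor_eq0 _ _ _ _ _ a) => b.
  rewrite Ia crd_eq -!addnS eqn_modDl !modn_small//; first by lia.
  - by rewrite !ltnS.
  - by rewrite (leq_trans c2).
by move=> [Ia|Ia]; [apply: (H 0)|apply: (H 1)]; rewrite // ?addn0 ?addn1.
Qed.

Definition edges (w : nat -> R) : altform R n q := \sum_(i < q.+2) w i *: edge i.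

Lemma coef_edges w I : coef (edges w) I = \sum_(i < q.+2) w i * coef (edge i) I.
Proof. by rewrite coef_sum. Qed.

Lemma coef_edges_notin w I a : ~~ cyclic (I a) -> coef (edges w) I = 0.
Proof.
by move=> Ia; rewrite coef_edges big1// => i _; rewrite (edge_notin _ Ia) mulr0.
Qed.

(** [I] contains an end of edge [i]; as [edge i] omits both ends, its coefficient at [I] is 0. *)
Definition avoids (I : 'I_q -> 'I_n) i := exists a, I a = crd i \/ I a = crd i.+1.

(** Every edge other than [i] is i + d modulo [q.+2] with 0 < d < q + 2, so a single term of the sum
    survives. *)
Lemma coef_edges_single w I i :
  (forall d, (0 < d < q.+2)%N -> avoids I (i + d)) ->
  coef (edges w) I = w (i %% q.+2)%N * coef (edge i) I.
Proof.
move=> Id; have im : (i %% q.+2 < q.+2)%N by rewrite ltn_pmod.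
rewrite coef_edges (bigD1 (Ordinal im))//= edge_mod big1 ?addr0// => j ji.
have {}ji : (j != i %% q.+2 :> nat)%N.
  by apply: contra_neq ji => ji; exact: val_inj.
pose d := ((j + q.+2 - i %% q.+2) %% q.+2)%N.
have dE : ((i + d) %% q.+2)%N = j.
  rewrite /d modnDmr -modnDml addnBA; last by lia.
  by rewrite addnC addnK modnDr modn_small.
have d0 : (0 < d < q.+2)%N.
  rewrite ltn_pmod// andbT lt0n; apply: contraNneq ji => d0.
  by rewrite -dE d0 addn0.
have [a aE] := Id d d0.
by rewrite -dE edge_mod (edge_end aE) mulr0.
Qed.

Lemma coef_edges_arc w i : coef (edges w) (arc i) = w (i %% q.+2)%N.
Proof.
rewrite (@coef_edges_single _ _ i) ?minor_id ?mulr1//; first apply: arc_inj.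
(* [arc i] omits only the vertices i and i + 1, so every other edge has an end in it: i + 2 when d =
   1, and i + d otherwise. *)
move=> [//|[|d]] /andP[_ dq].
  by exists (Ordinal hq); right; rewrite /arc/= addn0 addn1.
have dq' : (d < q)%N by [].
by exists (Ordinal dq'); left; rewrite /arc/= !addnS.
Qed.


(** The last entry of [arc i.+1] is i + q + 2, that is, vertex i. With i + 2 in its place the tuple
    lists the vertices of [arc i], cyclically shifted. *)
Lemma arc_shift i (b : 'I_q) : b.+1 = q ->
  dfwith (arc i.+1) b (crd i.+2) = fun a => arc i (perm (@ordS_inj q) a).
Proof.
move=> bq; apply/funext => a; rewrite /arc permE /=.
have [<-|ba] := eqVneq b a; first by rewrite dfwithin bq modnn addn0.
have aq : (a.+1 < q)%N by move: ba (ltn_ord a); rewrite -val_eqE/=; lia.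
by rewrite dfwithout// modn_small ?addnS ?addSn.
Qed.

(** The absolute values discard the sign of the cyclic shift in [arc_shift]. *)
Lemma coef_edges_dfwith_last w i (b : 'I_q) : b.+1 = q ->
  `|coef (edges w) (dfwith (arc i.+1) b (crd i.+2))| = `|w (i %% q.+2)%N|.
Proof.
move=> bq; rewrite (@coef_edges_single _ _ i); last first.
  move=> [//|[|[|d]]] /andP[_ dq].
  - by exists b; right; rewrite dfwithin addn1.
  - by exists b; left; rewrite dfwithin addn2.
  have dq' : (d < q)%N by lia.
  exists (Ordinal dq'); left; rewrite dfwithout; last by rewrite -val_eqE/=; lia.
  by rewrite /arc/= !addnS !addSn.
rewrite arc_shift// minor_perm; last apply: arc_inj.
by rewrite normrM normrX normrN1 expr1n mulr1.
Qed.

(** The new tuple omits the vertices i + 1 and i + b + 3, which are not adjacent on the cycle when b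
    + 1 < q, so no edge monomial survives. *)
Lemma coef_edges_dfwith w i (b : 'I_q) : (b.+1 < q)%N ->
  coef (edges w) (dfwith (arc i.+1) b (crd i.+2)) = 0.
Proof.
move=> bq; rewrite (@coef_edges_single _ _ i.+1); last first.
  move=> [//|[|d]] /andP[_ dq]; first by exists b; left; rewrite dfwithin addn1.
  have [db|db] := eqVneq d b.
    exists (Ordinal bq); right; rewrite dfwithout; last by rewrite -val_eqE/=; lia.
    by rewrite /arc/= db !addnS !addSn.
  have dq' : (d < q)%N by lia.
  exists (Ordinal dq'); left; rewrite dfwithout; last by rewrite -val_eqE/= eq_sym.
  by rewrite /arc/= !addnS !addSn.
by rewrite (@edge_end _ _ b) ?mulr0// dfwithin; right.
Qed.

Definition cons_idx (c : 'I_n) (I : 'I_q -> 'I_n) (j : 'I_q.+1) : 'I_n :=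
  oapp I c (unlift ord0 j).

Lemma cons_idx0 c I : cons_idx c I ord0 = c.
Proof. by rewrite /cons_idx unlift_none. Qed.

Lemma cons_idxS c I b : cons_idx c I (lift ord0 b) = I b.
Proof. by rewrite /cons_idx liftK. Qed.

Lemma dfwith_cons0 c c' I : dfwith (cons_idx c I) ord0 c' = cons_idx c' I.
Proof.
apply/funext => j; case: (unliftP ord0 j) => [b|] ->.
  by rewrite dfwithout ?cons_idxS// neq_lift.
by rewrite dfwithin cons_idx0.
Qed.

Lemma dfwith_consS c c' I b :
  dfwith (cons_idx c I) (lift ord0 b) c' = cons_idx c (dfwith I b c').
Proof.
apply/funext => j; case: (unliftP ord0 j) => [a|] ->; last first.
  by rewrite dfwithout ?cons_idx0// eq_sym neq_lift.
rewrite cons_idxS; have [<-|ba] := eqVneq b a; first by rewrite !dfwithin.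
by rewrite !dfwithout ?cons_idxS// (inj_eq lift_inj).
Qed.

Variable e : (1 + q = q.+1)%N.

Definition wave (w w' : nat -> R) : altform R n q.+1 :=
  ext_wedge e (dx R x0) (edges w) + ext_wedge e (dx R x1) (edges w').

(** The coefficient of [wave] on dx^c /\ E_i when [c] lies off the cycle, as [coef_wave_arc]
    shows. *)
Definition wave_weight (w w' : nat -> R) (c : 'I_n) (i : nat) : R :=
  (x0 == c)%:R * w i + (x1 == c)%:R * w' i.

Lemma coef_wedge_cons (a : 'I_n) w c I : ~~ cyclic c ->
  coef (ext_wedge e (dx R a) (edges w)) (cons_idx c I) =
  (a == c)%:R * coef (edges w) I.
Proof.
move=> yc; rewrite coef_wedge_dx big_ord_recl/= mul1r cons_idx0.
rewrite big1 ?addr0 => [|j _].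
  by congr (_ * coef _ _); apply/funext => l; rewrite cons_idxS.
rewrite (@coef_edges_notin _ _ (Ordinal hq)) ?mulr0//.
rewrite (_ : lift _ _ = ord0) ?cons_idx0//; exact: val_inj.
Qed.

Lemma coef_wave_cons w w' c I : ~~ cyclic c ->
  coef (wave w w') (cons_idx c I) =
  (x0 == c)%:R * coef (edges w) I + (x1 == c)%:R * coef (edges w') I.
Proof. by move=> yc; rewrite coefD !coef_wedge_cons. Qed.

Lemma coef_wave_arc w w' c i : ~~ cyclic c ->
  coef (wave w w') (cons_idx c (arc i)) = wave_weight w w' c (i %% q.+2).
Proof. by move=> yc; rewrite coef_wave_cons// !coef_edges_arc. Qed.

Lemma coef_wave_notin w w' c I a : ~~ cyclic c -> ~~ cyclic (I a) ->
  coef (wave w w') (cons_idx c I) = 0.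
Proof.
by move=> yc yI; rewrite coef_wave_cons// !(coef_edges_notin _ yI) !mulr0 addr0.
Qed.

Lemma coef_wave_cyclic w w' I : (forall j, cyclic (I j)) -> coef (wave w w') I = 0.
Proof.
move=> yI; rewrite coefD !coef_wedge_dx !big1 ?addr0// => j _.
  rewrite (negPf (_ : x1 != I j)) ?mul0r ?mulr0//.
  by apply: contraTneq (yI j) => <-; rewrite cyclic_x1.
rewrite (negPf (_ : x0 != I j)) ?mul0r ?mulr0//.
by apply: contraTneq (yI j) => <-.
Qed.

Lemma coef_wave_dfwith w w' c i (b : 'I_q) : ~~ cyclic c -> (b.+1 < q)%N ->
  coef (wave w w') (cons_idx c (dfwith (arc i.+1) b (crd i.+2))) = 0.
Proof.
by move=> yc bq; rewrite coef_wave_cons// !coef_edges_dfwith// !mulr0 addr0.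
Qed.

Lemma coef_wave_dfwith_last w w' c i (b : 'I_q) : ~~ cyclic c -> b.+1 = q ->
  `|coef (wave w w') (cons_idx c (dfwith (arc i.+1) b (crd i.+2)))| =
  `|wave_weight w w' c (i %% q.+2)|.
Proof.
move=> yc bq; rewrite coef_wave_cons// /wave_weight.
have [<-|_] := eqVneq x0 c.
  by rewrite x1_neq0 !mul0r !addr0 !mul1r coef_edges_dfwith_last.
have [_|_] := eqVneq x1 c; last by rewrite !mul0r.
by rewrite !mul0r !add0r !mul1r coef_edges_dfwith_last.
Qed.

End cyclic_family.

(** * Approximate divisibility along the cycle *)

Section divisible_estimate.
Context (R : realType) (n' q : nat).
Hypotheses (hq : (0 < q)%N) (hn : (q.+3 <= n')%N).
Local Notation n := n'.+1.
Local Notation V := 'rV[R]_n.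
Variable e : (1 + q = q.+1)%N.
Local Notation crd := (@crd n' q).
Local Notation cyclic := (@cyclic n' q).
Local Notation x0 := (x0 n').
Local Notation x1 := (x1 n').

Lemma basis_dfwith k (I : 'I_k -> 'I_n) i c :
  (fun j => basis_vec R (dfwith I i c j)) =
  dfwith (fun j => basis_vec R (I j)) i (basis_vec R c).
Proof.
apply/funext => j; have [<-|ij] := eqVneq i j; first by rewrite !dfwithin.
by rewrite !dfwithout.
Qed.

Context (eta : altform R n q.+1) (b : {scalar V}) (w w' : nat -> R) (B D : R).
Hypotheses (eta0 : forall v, (forall i, b (v i) = 0) -> eta v = 0)
  (hB : forall c, `|b (basis_vec R c)| <= B)
  (hD : forall J, `|coef (eta - wave n' e w w') J| <= D).
Local Notation P := (wave n' e w w').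
Local Notation bc c := (b (basis_vec R c)).
Local Notation E := (q.+2%:R * (B * D)).

(** The exchange relation is exact for [eta]; passing to [P] costs at most B D in each of the [q.+2]
    terms. *)
Lemma approx_exchange c0 I :
  `|bc c0 * coef P I - \sum_i bc (I i) * coef P (dfwith I i c0)| <= E.
Proof.
have := exchange (basis_vec R c0) (fun j => basis_vec R (I j)) eta0.
rewrite /exchange_rel -/(coef eta I) => H.
have PE J : coef P J = coef eta J - coef (eta - P) J.
  by rewrite coefD coefN; ring.
rewrite PE mulrBr H; under [X in _ - X]eq_bigr do rewrite PE mulrBr.
rewrite sumrB.
under [X in _ - (X - _)]eq_bigr do rewrite /coef basis_dfwith.
rewrite opprB addrC subrKA.
rewrite (le_trans (ler_normB _ _))// -natr1 mulrDl mul1r.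
have bD c J : `|bc c * coef (eta - P) J| <= B * D.
  by rewrite normrM; apply: ler_pM.
apply: lerD => //; apply: le_trans (ler_norm_sum _ _ _) _.
rewrite -[q.+1 in leRHS]card_ord -sumr_const mulr_suml; apply: ler_sum => i _.
by rewrite mul1r.
Qed.

(** This is the coefficient of b /\ P on dx^c and all vertices but i + 1. Only the two edges meeting
    at i + 1 contribute: exchanging [c] leaves a tuple inside the cycle, and exchanging a vertex
    other than the last leaves two omitted vertices that are not adjacent. *)
Lemma weight_step c i : ~~ cyclic c ->
  `| `|bc (crd i.+2)| * `|wave_weight w w' c (i.+1 %% q.+2)| -
     `|bc (crd i)| * `|wave_weight w w' c (i %% q.+2)| | <= E.
Proof.
move=> yc; have := approx_exchange (crd i.+2) (cons_idx c (arc n' i.+1)).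
rewrite (coef_wave_arc hq hn)// big_ord_recl dfwith_cons0 (coef_wave_cyclic hn)//; last first.
  move=> j; case: (unliftP ord0 j) => [a|] ->; rewrite ?cons_idx0 ?cons_idxS//.
    exact: (cyclic_crd hn).
  exact: (cyclic_crd hn).
rewrite mulr0 add0r.
have q1 : (q.-1 < q)%N by rewrite prednK.
pose l := Ordinal q1; have lq : l.+1 = q by rewrite prednK.
rewrite (bigD1 l)//= big1 ?addr0 => [|j jl]; last first.
  rewrite dfwith_consS (coef_wave_dfwith hq hn) ?mulr0//.
  by move: jl (ltn_ord j); rewrite -val_eqE/=; lia.
rewrite dfwith_consS cons_idxS.
have -> : arc n' i.+1 l = crd i.
  by apply/eqP; rewrite (crd_eq hn)/= -[(_ + _).+2]/((i + q.-1).+3)%N -!addnS prednK// modnDr.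
move=> H; apply: le_trans H.
rewrite -(coef_wave_dfwith_last hq hn e w w' i yc lq) -!normrM.
exact: ler_dist_dist.
Qed.

(** This is the coefficient of b /\ P on dx^c /\ dx^c' /\ E_i. Exchanging an entry of the arc leaves
    two off-cycle indices, where [P] has coefficient 0. *)
Lemma weight_pair c c' i : ~~ cyclic c -> ~~ cyclic c' ->
  `|bc c' * wave_weight w w' c (i %% q.+2) -
    bc c * wave_weight w w' c' (i %% q.+2)| <= E.
Proof.
move=> yc yc'; have := approx_exchange c' (cons_idx c (arc n' i)).
rewrite (coef_wave_arc hq hn)// big_ord_recl dfwith_cons0 (coef_wave_arc hq hn)// cons_idx0.
rewrite big1 ?addr0// => j _; rewrite dfwith_consS.
by rewrite (@coef_wave_notin _ _ _ hq hn _ _ _ _ _ j) ?mulr0// dfwithin.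
Qed.

End divisible_estimate.

(** * Two of the three amplitudes are small *)

Section two_small.
Context (R : realType) (n' q : nat).
Hypotheses (hq : (0 < q)%N) (hn : (q.+3 <= n')%N).
Local Notation n := n'.+1.
Local Notation V := 'rV[R]_n.
Variable e : (1 + q = q.+1)%N.
Local Notation crd := (@crd n' q).
Local Notation cyclic := (@cyclic n' q).
Local Notation x0 := (x0 n').
Local Notation x1 := (x1 n').

(* Odd edges carry r, even edges t, and the closing edge {q+1, 0} carries s. *)
Definition edge_weight (r s t : R) (i : nat) : R :=
  if i == q.+1 then s else if odd i then r else t.

Lemma le2_dist (a c F : R) : `|a - c| <= F -> a <= F -> c <= 2 * F.
Proof. by rewrite ler_distl; lra. Qed.

Lemma le2_distC (a c F : R) : `|a - c| <= F -> c <= F -> a <= 2 * F.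
Proof. by rewrite distrC; exact: le2_dist. Qed.

(** The form r dx^p /\ A + s dx^q /\ B + t (dx^p + dx^q) /\ C of the overview. The closing edge
    belongs to B only, whatever its parity. *)
Definition plane (r s t : R) : altform R n q.+1 :=
  wave n' e (edge_weight r 0 t) (edge_weight 0 s t).

Definition two_small (K r s t : R) :=
  [\/ `|r| <= K /\ `|s| <= K, `|r| <= K /\ `|t| <= K | `|s| <= K /\ `|t| <= K].

(** The covector is normalised at a coordinate [c0] where it is largest: the errors scale with
    |b(c0)|, so it suffices to bound the products of [nb c0] with two of the amplitudes. The cases
    are [c0] on the cycle, [c0] equal to [x0] or [x1], and any other [c0]. *)
Lemma plane_two_small (eta : altform R n q.+1) (b : {scalar V}) (r s t D : R) :
  (forall v, (forall i, b (v i) = 0) -> eta v = 0) ->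
  (exists c, b (basis_vec R c) != 0) ->
  (forall J, `|coef (eta - plane r s t) J| <= D) ->
  two_small (2 * q.+2%:R * D) r s t.
Proof.
move=> eta0 [c1 bc1] hD.
pose nb c := `|b (basis_vec R c)|.
pose c0 := [arg max_(c > c1) nb c]%O.
have c0max c : nb c <= nb c0.
  by rewrite /c0; case: arg_maxP => //= i _; apply.
have nb_norm c (x : R) : `|nb c * `|x| | = nb c * `|x| by rewrite normrM !normr_id.
have nb0 : 0 < nb c0 by rewrite (lt_le_trans _ (c0max c1))// normr_gt0.
have D0 : 0 <= D by rewrite (le_trans _ (hD (fun=> ord0))).
set E := 2 * _ * _.
have scale (x : R) : `|x| * nb c0 <= 2 * (q.+2%:R * (nb c0 * D)) -> `|x| <= E.
  by move=> h; rewrite -(ler_pM2r nb0) (le_trans h)// /E -!mulrA [D * _]mulrC.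
have step := weight_step hq hn eta0 c0max hD.
have pair := weight_pair hq hn eta0 c0max hD.
move: step pair; set F := q.+2%:R * _ => step pair.
have F0 : 0 <= F by rewrite /F !mulr_ge0// ltW.
have F2 : F <= 2 * F by rewrite mulr2n mulrDl mul1r lerDl.
have E0 : 0 <= E by rewrite /E !mulr_ge0.
have cx0 : ~~ cyclic x0 by [].
have cx1 : ~~ cyclic x1 by rewrite (cyclic_x1 hn).
set w := edge_weight r 0 t in step pair *; set w' := edge_weight 0 s t in step pair *.
have wt0 i : wave_weight w w' x0 i = w i.
  by rewrite /wave_weight eqxx (x1_neq0 hn) mul1r mul0r addr0.
have wt1 i : wave_weight w w' x1 i = w' i.
  by rewrite /wave_weight eqxx eq_sym (x1_neq0 hn) mul1r mul0r add0r.
have w0 i : i = q.+1 -> w i = 0 by move=> ->; rewrite /w /edge_weight eqxx.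
have wr i : (i < q.+1)%N -> odd i -> w i = r.
  by move=> iq oi; rewrite /w /edge_weight oi ltn_eqF.
have wt i : (i < q.+1)%N -> ~~ odd i -> w i = t.
  by move=> iq /negPf oi; rewrite /w /edge_weight oi ltn_eqF.
have w's i : i = q.+1 -> w' i = s by move=> ->; rewrite /w' /edge_weight eqxx.
have w'0 i : (i < q.+1)%N -> odd i -> w' i = 0.
  by move=> iq oi; rewrite /w' /edge_weight oi ltn_eqF.
have w't i : (i < q.+1)%N -> ~~ odd i -> w' i = t.
  by move=> iq /negPf oi; rewrite /w' /edge_weight oi ltn_eqF.
clearbody w w'.
have stepw i : (i < q.+1)%N ->
    `|nb (crd i.+2) * `|w i.+1| - nb (crd i) * `|w i| | <= F.
  by move=> iq; have := step _ i cx0; rewrite !wt0 !modn_small// ltnW.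
have stepw' i : (i < q.+1)%N ->
    `|nb (crd i.+2) * `|w' i.+1| - nb (crd i) * `|w' i| | <= F.
  by move=> iq; have := step _ i cx1; rewrite !wt1 !modn_small// ltnW.
have crd_top j : crd (q.+2 + j) = crd j by apply/eqP; rewrite (crd_eq hn) modnDl.
have stepw1 : nb (crd 1) * `|t| <= F.
  have := step _ q.+1 cx0; rewrite !wt0 modnn (modn_small (ltnSn _)) (w0 q.+1)//.
  by rewrite normr0 mulr0 subr0 wt// -[q.+3]addn1 crd_top nb_norm.
have stepw'1 : nb (crd q.+1) * `|s| <= 2 * F.
  have := step _ q.+1 cx1; rewrite !wt1 modnn (modn_small (ltnSn _)) (w's q.+1)//.
  by rewrite w't// -[q.+3]addn1 crd_top => /le2_dist; apply.
(* One step at [j] links an edge carrying [t] to an edge of weight 0: odd edges have weight 0 in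
   [w'], and the closing edge has weight 0 in [w]. The only vertex left out is q + 1 when it is
   even. *)
have tsmall j : (j < q.+1)%N || odd j && (j < q.+2)%N -> nb (crd j) * `|t| <= F.
  case oj: (odd j) => jq.
    case: j oj jq => [//|[//|i]] /= oi jq; have iq : (i < q)%N by move: jq; clear; lia.
    move: oi; rewrite negbK => oi; have := stepw' i (ltnW iq).
    rewrite w't//= ?oi// w'0// 1?ltnW//.
    by rewrite normr0 mulr0 subr0 nb_norm.
  rewrite orbF ltnS leq_eqVlt in jq; case/orP: jq => [/eqP jq|jq].
    have := stepw q (ltnSn q); rewrite jq in oj *.
    by rewrite w0// wt ?oj// normr0 mulr0 sub0r normrN nb_norm.
  have := stepw' j (ltnW jq); rewrite w'0//= ?oj// w't ?oj// 1?ltnW//.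
  by rewrite normr0 mulr0 sub0r normrN nb_norm.
(* In [w] the amplitudes [r] and [t] alternate, so a step passes smallness from [t] to [r] at the
   price of a factor 2; for odd j = q the closing edge bounds [r] directly. Vertex 0 is left out,
   and q + 1 when it is odd. *)
have rsmall j : (0 < j < q.+1)%N || ~~ odd j && (0 < j < q.+2)%N ->
    nb (crd j) * `|r| <= 2 * F.
  case oj: (odd j) => jq; last first.
    case: j oj jq => [//|[//|i]] /= oi jq; have iq : (i < q)%N by move: jq; clear; lia.
    have {}oi : odd i = false by rewrite -oi negbK.
    have ti : nb (crd i) * `|t| <= F by apply: tsmall; rewrite ltnS ltnW.
    have wi1 : w i.+1 = r by apply: wr; rewrite //= oi.
    have wi : w i = t by apply: wt; rewrite ?oi// ltnS ltnW.
    have := stepw i (ltnW iq); rewrite wi1 wi.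
    by move/le2_distC; apply.
  move: jq => /=; rewrite orbF => /andP[j0]; rewrite ltnS leq_eqVlt => /orP[/eqP jq|jq].
    have := stepw q (ltnSn q); rewrite jq in oj *.
    by rewrite w0// wr// normr0 mulr0 sub0r normrN nb_norm => /le_trans; apply.
  have tj : nb (crd j.+2) * `|t| <= F.
    by apply: tsmall; rewrite /= oj/= !ltnS jq orbT.
  have := stepw j (ltnW jq); rewrite wt//= ?oj// wr// 1?ltnW//.
  by move/le2_dist; apply.
(* The closing edge has ends 0 and q + 1; the latter is treated in [stepw'1]. *)
have ssmall : nb (crd 0) * `|s| <= 2 * F.
  have := stepw' q (ltnSn q); rewrite w's// -[q.+2]addn0 crd_top.
  have [oq|oq] := boolP (odd q).
    by rewrite w'0// normr0 mulr0 subr0 nb_norm => /le_trans; apply.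
  rewrite w't// => /le2_distC; apply; by apply: tsmall; rewrite ltnSn.
have scale' (x : R) : nb c0 * `|x| <= 2 * F -> `|x| <= E.
  by move=> h; apply: scale; rewrite mulrC.
have scale1 (x : R) : nb c0 * `|x| <= F -> `|x| <= E.
  by move=> h; apply: scale'; exact: le_trans h F2.
(* On the cycle, s and t are small at vertex 0, and r and t at the vertices 1, ..., q. At q + 1, s
   is small together with t or r, according to whether q + 1 is odd or even. *)
have [/(cyclicP hq hn)[j jq c0E]|yc0] := boolP (cyclic c0).
  have [j0|j0] := posnP j.
    apply: Or33; split; last by apply: scale1; rewrite c0E tsmall// j0.
    by apply: scale'; rewrite c0E j0.
  move: jq; rewrite ltnS leq_eqVlt => /orP[/eqP jq|jq].
    have sE : `|s| <= E by apply: scale'; rewrite c0E jq.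
    have [oj|oj] := boolP (odd j).
      by apply: Or33; split => //; apply: scale1; rewrite c0E tsmall// oj jq ltnSn orbT.
    by apply: Or31; split => //; apply: scale'; rewrite c0E rsmall// oj j0 jq ltnn ltnSn.
  apply: Or32; split; first by apply: scale'; rewrite c0E rsmall// j0 jq.
  by apply: scale1; rewrite c0E tsmall// jq.
have pair0 c c' : ~~ cyclic c -> ~~ cyclic c' ->
    `|b (basis_vec R c') * wave_weight w w' c 0 -
      b (basis_vec R c) * wave_weight w w' c' 0| <= F.
  by move=> yc yc'; have := pair c c' 0%N yc yc'; rewrite mod0n.
have pair1 c c' : ~~ cyclic c -> ~~ cyclic c' ->
    `|b (basis_vec R c') * wave_weight w w' c 1 -
      b (basis_vec R c) * wave_weight w w' c' 1| <= F.
  by move=> yc yc'; have := pair c c' 1%N yc yc'; rewrite modn_small.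
have pairq c c' : ~~ cyclic c -> ~~ cyclic c' ->
    `|b (basis_vec R c') * wave_weight w w' c q.+1 -
      b (basis_vec R c) * wave_weight w w' c' q.+1| <= F.
  by move=> yc yc'; have := pair c c' q.+1 yc yc'; rewrite modn_small.
(* Since u = v + (u - v), one of |v| and |u - v| is at least |u| / 2. *)
have half (u v y : R) : `|u| = nb c0 -> `|v * y| <= F -> `|(u - v) * t| <= F ->
    `|y| <= E \/ `|t| <= E.
  move=> u0; rewrite !normrM => vr uvt; have [vu|uv] := leP `|u| (2 * `|v|).
    left; apply: scale'; rewrite -u0 (le_trans (ler_wpM2r _ vu))// -mulrA.
    by rewrite ler_pM2l.
  right; apply: scale'; rewrite -u0.
  have uv2 : `|u| <= 2 * `|u - v|.
    by have := ler_normD (u - v) v; rewrite subrK; lra.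
  by rewrite (le_trans (ler_wpM2r _ uv2))// -mulrA ler_pM2l.
have s_case : `|r| <= E \/ `|t| <= E -> `|s| <= E -> two_small E r s t.
  by move=> [rE|tE] sE; [apply: Or31|apply: Or33].
have r_case : `|s| <= E \/ `|t| <= E -> `|r| <= E -> two_small E r s t.
  by move=> [sE|tE] rE; [apply: Or31|apply: Or32].
(* With b_0 and b_1 the values of [b] on the directions [x0] and [x1], edges 0, 1 and q + 1 bound
   (b_0 - b_1) t, b_1 r and b_0 s. *)
have := pairq x1 x0 cx1 cx0; have := pair1 x1 x0 cx1 cx0.
have := pair0 x1 x0 cx1 cx0; rewrite !wt1 !wt0.
rewrite (w0 q.+1)// (w's q.+1)// (w'0 1)// (wr 1)// (w't 0)// (wt 0)//.
rewrite !mulr0 subr0 sub0r normrN -mulrBl => h0 h1 hs.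
have [c0x0|c0x0] := eqVneq c0 x0.
  apply: s_case; last by apply: scale1; rewrite c0x0 -normrM.
  by apply: (half _ _ _ _ h1 h0); rewrite c0x0.
have [c0x1|c0x1] := eqVneq c0 x1.
  apply: r_case; last by apply: scale1; rewrite c0x1 -normrM.
  by apply: (half (b (basis_vec R x1)) _ _ _ hs); rewrite ?c0x1// -opprB mulNr normrN.
(* Any remaining coordinate has weight 0, so pairing it with [x0] bounds r and t directly. *)
have wtc i : wave_weight w w' c0 i = 0.
  by rewrite /wave_weight ![_ == c0]eq_sym (negPf c0x0) (negPf c0x1) !mul0r addr0.
apply: Or32; split; apply: scale1; rewrite -normrM.
  by have := pair1 x0 c0 cx0 yc0; rewrite wtc mulr0 subr0 wt0 wr.
by have := pair0 x0 c0 cx0 yc0; rewrite wtc mulr0 subr0 wt0 wt.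
Qed.

End two_small.

(** * The integrand *)

Arguments alt_coef : simpl never.

Section quartic.
Context (R : realType).

(* Second divided differences of t^2, t^3, t^4 are 1, h1, h2 (complete homogeneous
   polynomials), and h2 >= 2/3 h1^2: so they are bounded below by half the second
   derivative at the mean h1/3 of the three nodes. *)
Lemma convex_quartic (phi : R^o -> R^o) (c0 c1 c2 c3 c4 : R) :
  (forall t, phi t = c0 + c1 * t + c2 * t ^+ 2 + c3 * t ^+ 3 + c4 * t ^+ 4) ->
  0 <= c4 -> (forall t, 0 <= c2 + 3 * c3 * t + 6 * c4 * t ^+ 2) ->
  convex_function [set: R^o] phi.
Proof.
move=> phiE c40 c20 l x y _ _.
have l0 : 0 <= l%:num by [].
have l1 : l%:num <= 1 by [].
have -> : phi (conv l x y) = phi (l%:num * x + (1 - l%:num) * y) by [].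
have -> : conv l (phi x) (phi y) = l%:num * phi x + (1 - l%:num) * phi y by [].
move: (l%:num : R) x y l0 l1 => {}l x y l0 l1; rewrite !phiE.
set z := l * x + (1 - l) * y.
have := c20 ((x + y + z) / 3).
set D := c2 + c3 * (x + y + z) +
  c4 * (x ^+ 2 + y ^+ 2 + z ^+ 2 + x * y + y * z + z * x).
have DE : D = c2 + 3 * c3 * ((x + y + z) / 3) + 6 * c4 * ((x + y + z) / 3) ^+ 2 +
    c4 * ((x - y) ^+ 2 + (y - z) ^+ 2 + (z - x) ^+ 2) / 6.
  by rewrite /D; field.
move=> h; have D0 : 0 <= D.
  by rewrite DE addr_ge0// divr_ge0// mulr_ge0// !addr_ge0// sqr_ge0.
rewrite -subr_ge0 [leRHS](_ : _ = l * (1 - l) * (x - y) ^+ 2 * D).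
  apply: mulr_ge0 => //; apply: mulr_ge0; last exact: sqr_ge0.
  by apply: mulr_ge0 => //; rewrite subr_ge0.
by rewrite /D /z; ring.
Qed.

(** Half the second derivative of the integrand along eta: [m] and [nu] stand for the norms of xi
    and eta, [p] for their inner product, [d] for the norm of the off-plane part of eta. Each
    product of two of r', s', t' has a factor at most K d, so the cubic part is at most 3 K m nu d;
    9 K^2 <= 8 eps gam is the discriminant condition that absorbs it into 2 eps m^2 nu^2 + gam
    d^2. *)
Lemma second_order_ge0 (K eps gam r s t r' s' t' m nu d p : R) :
  0 < eps -> 9 * K ^+ 2 <= 8 * eps * gam -> 0 <= K -> 0 <= m -> 0 <= nu -> 0 <= d ->
  `|r| <= m -> `|s| <= m -> `|t| <= m ->
  `|r'| <= nu -> `|s'| <= nu -> `|t'| <= nu -> two_small (K * d) r' s' t' ->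
  0 <= - (r * s' * t' + s * r' * t' + t * r' * s') +
       eps * (2 * m ^+ 2 * nu ^+ 2 + 4 * p ^+ 2) + gam * d ^+ 2.
Proof.
move=> e0 eg K0 m0 nu0 d0 rm sm tm rn sn tn small.
have prod (x y : R) : (`|x| <= K * d) /\ (`|y| <= nu) \/
    (`|x| <= nu) /\ (`|y| <= K * d) -> `|x| * `|y| <= K * d * nu.
  by case=> -[xl yl]; [|rewrite [leRHS]mulrC]; apply: ler_pM.
have term (x y z : R) : `|x| <= m -> `|y| * `|z| <= K * d * nu ->
    x * y * z <= m * (K * d * nu).
  move=> xm yz; apply: le_trans (ler_norm _) _; rewrite -mulrA !normrM.
  by apply: ler_pM => //; rewrite mulr_ge0.
have h1 : r * s' * t' <= m * (K * d * nu).
  by apply: term => //; apply: prod; case: small => -[]; auto.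
have h2 : s * r' * t' <= m * (K * d * nu).
  by apply: term => //; apply: prod; case: small => -[]; auto.
have h3 : t * r' * s' <= m * (K * d * nu).
  by apply: term => //; apply: prod; case: small => -[]; auto.
have p0 : 0 <= eps * p ^+ 2 by rewrite mulr_ge0 ?sqr_ge0// ltW.
have q0 : 0 <= 2 * eps * (m * nu) ^+ 2 - 3 * K * (m * nu) * d + gam * d ^+ 2.
  rewrite -(@pmulr_rge0 _ (8 * eps)) ?mulr_gt0//.
  have -> : 8 * eps * (2 * eps * (m * nu) ^+ 2 - 3 * K * (m * nu) * d + gam * d ^+ 2) =
     (4 * eps * (m * nu) - 3 * K * d) ^+ 2 + (8 * eps * gam - 9 * K ^+ 2) * d ^+ 2 by ring.
  by rewrite addr_ge0 ?sqr_ge0// mulr_ge0 ?sqr_ge0// subr_ge0.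
move: h1 h2 h3 p0 q0; rewrite exprMn; lra.
Qed.

End quartic.

Section inner_product.
Context (R : realType) (n k : nat).
Implicit Types w : altform R n k.

Lemma alt_coef_line w w' t I :
  alt_coef (w + t *: w') I = alt_coef w I + t * alt_coef w' I.
Proof. by []. Qed.

Definition ip w w' := \sum_I alt_coef w I * alt_coef w' I.
Definition sqn w := \sum_I alt_coef w I ^+ 2.

Lemma sqn_line w w' t :
  sqn (w + t *: w') = sqn w + 2 * ip w w' * t + sqn w' * t ^+ 2.
Proof.
rewrite /sqn /ip mulr_sumr !mulr_suml -!big_split/=; apply: eq_bigr => I _.
by rewrite alt_coef_line; ring.
Qed.

Lemma sqn_ge0 w : 0 <= sqn w.
Proof. by apply: sumr_ge0 => I _; exact: sqr_ge0. Qed.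

Lemma coef_le_sqn w I : `|coef w I| <= Num.sqrt (sqn w).
Proof.
rewrite -sqrtr_sqr ler_wsqrtr// coefE /sqn (bigD1 (finfun I))//= lerDl.
by apply: sumr_ge0 => J _; exact: sqr_ge0.
Qed.

End inner_product.

Section wedge_linear.
Context (R : realType) (n p q r : nat) (e : (p + q = r)%N).

Lemma wedge_linear_r (a : altform R n p) c (b b' : altform R n q) :
  ext_wedge e a (c *: b + b') = c *: ext_wedge e a b + ext_wedge e a b'.
Proof.
apply: altform_ext => v.
rewrite /= -[RHS]/(c * ext_wedge_fun e a b v + ext_wedge_fun e a b' v).
rewrite /ext_wedge_fun [c * (_ * _)]mulrCA -mulrDr; congr (_ * _).
rewrite mulr_sumr -big_split/=; apply: eq_bigr => s _.
set y := fun j : 'I_q => v _.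
by rewrite [X in _ * (_ * X)](_ : _ = c * b y + b' y)// !mulrDr !(mulrCA _ c).
Qed.

Lemma wedge0r (a : altform R n p) : ext_wedge e a (0 : altform R n q) = 0.
Proof. by have := wedge_linear_r a (-1) 0 0; rewrite scaler0 addr0 scaleN1r addNr. Qed.

End wedge_linear.

Section integrand.
Context (R : realType) (n' q : nat).
Hypotheses (hq : (0 < q)%N) (hn : (q.+3 <= n')%N).
Local Notation n := n'.+1.
Local Notation V := 'rV[R]_n.
Variable e : (1 + q = q.+1)%N.
Local Notation arc := (@arc n' q).
Local Notation x0 := (x0 n').
Local Notation x1 := (x1 n').
Implicit Types xi eta : altform R n q.+1.

Lemma edges_linear a (w w' : nat -> R) :
  edges n' q (fun i => a * w i + w' i) = a *: edges n' q w + edges n' q w'.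
Proof.
rewrite /edges scaler_sumr -big_split/=; apply: eq_bigr => i _.
by rewrite scalerDl scalerA.
Qed.

Lemma edge_weight_linear a (r s t r' s' t' : R) :
  edge_weight q (a * r + r') (a * s + s') (a * t + t') =
  (fun i => a * edge_weight q r s t i + edge_weight q r' s' t' i).
Proof. by apply/funext => i; rewrite /edge_weight; do !case: ifP. Qed.

Lemma plane_linear a (r s t r' s' t' : R) :
  plane n' e (a * r + r') (a * s + s') (a * t + t') =
  a *: plane n' e r s t + plane n' e r' s' t'.
Proof.
rewrite /plane /wave -{1}[0](addr0 (0 : R)) -{1}(mulr0 a) edge_weight_linear.
rewrite -{3}[0](addr0 (0 : R)) -{3}(mulr0 a) edge_weight_linear.
by rewrite !edges_linear !wedge_linear_r scalerDr addrACA.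
Qed.

(** Edges 1, q + 1 and 0 represent the odd edges, the closing edge and the even edges. Reading one
    coefficient of each makes [proj] a linear projection onto the [plane] forms, not the orthogonal
    one; [sqn (off xi)] stands for the squared distance of the overview. *)
Definition amp_r xi := coef xi (cons_idx x0 (arc 1)).
Definition amp_s xi := coef xi (cons_idx x1 (arc q.+1)).
Definition amp_t xi := coef xi (cons_idx x0 (arc 0)).
Definition proj xi := plane n' e (amp_r xi) (amp_s xi) (amp_t xi).
Definition off xi := xi - proj xi.

Definition integrand (eps gam : R) xi : R :=
  - (amp_r xi * amp_s xi * amp_t xi) + eps * sqn xi ^+ 2 + gam * sqn (off xi).

Lemma amp_plane r s t : [/\ amp_r (plane n' e r s t) = r,
  amp_s (plane n' e r s t) = s & amp_t (plane n' e r s t) = t].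
Proof.
rewrite /amp_r /amp_s /amp_t /plane !(coef_wave_arc hq hn) ?(cyclic_x1 hn)//.
rewrite !modn_small// /wave_weight !eqxx (x1_neq0 hn) eq_sym (x1_neq0 hn).
by rewrite !mul1r !mul0r !addr0 add0r /edge_weight/= eqxx eqSS; case: q hq.
Qed.

Lemma off_plane r s t : off (plane n' e r s t) = 0.
Proof. by have [rE sE tE] := amp_plane r s t; rewrite /off /proj rE sE tE subrr. Qed.

Lemma proj_linear a xi eta : proj (a *: xi + eta) = a *: proj xi + proj eta.
Proof. exact: plane_linear. Qed.

Lemma off_linear a xi eta : off (a *: xi + eta) = a *: off xi + off eta.
Proof. by rewrite /off proj_linear scalerBr opprD addrACA. Qed.

(** [plane_two_small] applies to [proj eta], since each coefficient of [off eta] is at most its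
    Euclidean norm. When [beta] vanishes on the basis, so do all coefficients of [eta]. *)
Lemma wedge_two_small p (e' : (p + 1 = q.+1)%N) (alpha : altform R n p)
    (beta : altform R n 1) (eta := ext_wedge e' alpha beta) :
  two_small (2 * q.+2%:R * Num.sqrt (sqn (off eta))) (amp_r eta) (amp_s eta) (amp_t eta).
Proof.
have eta0 (v : 'I_q.+1 -> V) : (forall i, form1 beta (v i) = 0) -> eta v = 0.
  exact: wedge_ker_eq0.
have [b0|] := pselect (forall c, form1 beta (basis_vec R c) = 0).
  have c0 I : coef eta I = 0 by apply: eta0 => i; exact: b0.
  have E0 : 0 <= 2 * q.+2%:R * Num.sqrt (sqn (off eta)) by rewrite !mulr_ge0// sqrtr_ge0.
  by apply: Or31; rewrite /amp_r /amp_s !c0 normr0.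
move=> /existsNP[c /eqP bc].
apply: (plane_two_small hq hn (e := e) (b := form1 beta) eta0).
  by exists c.
by move=> J; exact: coef_le_sqn.
Qed.

Lemma integrand_one_convex eps gam : 0 < eps ->
  9 * (2 * q.+2%:R) ^+ 2 <= 8 * eps * gam -> ext_one_convex (integrand eps gam).
Proof.
move=> eps0 epsgam p e' xi alpha beta; set eta := ext_wedge _ _ _.
pose r := amp_r xi; pose s := amp_s xi; pose t := amp_t xi.
pose r' := amp_r eta; pose s' := amp_s eta; pose t' := amp_t eta.
pose M := sqn xi; pose N := sqn eta; pose b := ip xi eta.
have offE x : off (xi + x *: eta) = off xi + x *: off eta.
  by rewrite addrC off_linear addrC.
have [rE sE tE] : [/\ forall x, amp_r (xi + x *: eta) = r + x * r',
  forall x, amp_s (xi + x *: eta) = s + x * s' &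
  forall x, amp_t (xi + x *: eta) = t + x * t'] by [].
apply: (@convex_quartic R _
  (- (r * s * t) + eps * M ^+ 2 + gam * sqn (off xi))
  (- (r' * s * t + r * s' * t + r * s * t') + 4 * eps * M * b
    + 2 * gam * ip (off xi) (off eta))
  (- (r * s' * t' + s * r' * t' + t * r' * s') + eps * (2 * M * N + 4 * b ^+ 2)
    + gam * sqn (off eta))
  (- (r' * s' * t') + 4 * eps * b * N) (eps * N ^+ 2)).
- by move=> x; rewrite /integrand rE sE tE offE !sqn_line -/M -/N -/b; ring.
- by rewrite mulr_ge0 ?sqr_ge0// ltW.
(* The second-order bound is used at the base point xi + x eta, whose inner product with [eta] is b
   + N x. *)
move=> x; have := @second_order_ge0 R (2 * q.+2%:R) eps gam
  (r + x * r') (s + x * s') (t + x * t') r' s' t' (Num.sqrt (sqn (xi + x *: eta)))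
  (Num.sqrt N) (Num.sqrt (sqn (off eta))) (b + N * x).
rewrite !sqr_sqrtr ?sqn_ge0// => h.
have {}h := h eps0 epsgam (mulr_ge0 (ler0n _ _) (ler0n _ _)) (sqrtr_ge0 _)
  (sqrtr_ge0 _) (sqrtr_ge0 _).
rewrite -rE -sE -tE in h.
have {}h := h (coef_le_sqn _ _) (coef_le_sqn _ _) (coef_le_sqn _ _) (coef_le_sqn _ _)
  (coef_le_sqn _ _) (coef_le_sqn _ _) (wedge_two_small _ _ _).
apply: le_trans h _; rewrite le_eqVlt; apply/orP; left; apply/eqP.
by rewrite rE sE tE sqn_line -/M -/N -/b; ring.
Qed.

End integrand.

(** * Explicit smooth functions *)

Section line_derivative.
Context (R : realType) (V : normedModType R).
Implicit Types (f : V -> R) (x v : V).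

(** Both derivatives are limits of the same difference quotient; this transfers one-variable rules
    to directional derivatives. *)
Lemma is_derive_lineP f x v (d : R) :
  is_derive x v f d <-> is_derive (0 : R) 1 (fun h : R => f (h *: v + x)) d.
Proof.
have E : (fun h : R => h^-1 *: ((f \o shift x) (h *: v) - f x)) =
    (fun h : R => h^-1 *: (((fun h0 : R => f (h0 *: v + x)) \o shift 0) (h *: 1)
                           - f (0 *: v + x))).
  apply/funext => h /=; rewrite scale0r add0r.
  by rewrite /GRing.scale/= mulr1 addr0.
by split=> -[df <-]; split; rewrite /derivable /derive ?E// -?E.
Qed.

Lemma is_derive_comp (h : R -> R) f x v (a d : R) :
  is_derive (f x) 1 h a -> is_derive x v f d -> is_derive x v (h \o f) (a * d).
Proof.
move=> ha /is_derive_lineP fd; apply/is_derive_lineP.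
by apply: (@is_derive1_comp _ h (fun s : R => f (s *: v + x))); rewrite scale0r add0r.
Qed.

End line_derivative.

Lemma is_derive_line (R : realType) (V : normedModType R) (f : V -> R) x v (t d : R) :
  is_derive (x + t *: v) v f d -> is_derive t 1 (fun s : R => f (x + s *: v)) d.
Proof.
move=> /is_derive_lineP fd; apply/is_derive_lineP.
rewrite (_ : (fun _ => _) = fun h : R => f (h *: v + (x + t *: v)))//.
apply/funext => h; congr (f _).
by rewrite [h *: 1]mulr1 scalerDl addrCA.
Qed.

Section flat.
Context (R : realType).
Implicit Types (t : R) (j : nat).

(** [flat 0] is the usual exp(-1/t); the powers of 1/t make the span of the family closed under
    differentiation. *)
Definition flat j t : R := if 0 < t then t^-1 ^+ j * expR (- t^-1) else 0.

Lemma flat_le0 j t : t <= 0 -> flat j t = 0.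
Proof. by rewrite /flat leNgt => /negPf ->. Qed.

Lemma flat_gt0 j t : 0 < t -> 0 < flat j t.
Proof. by move=> t0; rewrite /flat t0 mulr_gt0 ?expR_gt0// exprn_gt0// invr_gt0. Qed.

Lemma flat_ge0 j t : 0 <= flat j t.
Proof. by have [/flat_le0 ->|/(flat_gt0 j)/ltW] := leP t 0. Qed.

(** With u = 1/t, the exponential exp u dominates u^(j+1) / (j+1)!. *)
Lemma flat_bound j t : `|flat j t| <= (j.+1)`!%:R * `|t|.
Proof.
have [t0|t0] := leP t 0; first by rewrite flat_le0// normr0 mulr_ge0.
rewrite ger0_norm ?flat_ge0// gtr0_norm// /flat t0 expRN.
have u0 : 0 < t^-1 by rewrite invr_gt0.
rewrite ler_pdivrMr ?expR_gt0//.
have := expR_ge1Dxn j (ltW u0); set u := t^-1 in u0 *.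
set F : R := _%:R => h.
have F0 : 0 < F by rewrite ltr0n fact_gt0.
have {}h : u ^+ j.+1 / F <= expR u by apply: le_trans h; rewrite lerDr.
rewrite ler_pdivrMr// in h.
have tu : t * u = 1 by rewrite divff// gt_eqF.
rewrite -(ler_pM2l u0) -exprS (le_trans h)// [leRHS](_ : _ = expR u * F * (t * u)).
  by rewrite tu mulr1.
by ring.
Qed.

Lemma is_derive_flat j t :
  is_derive t 1 (flat j) (- j%:R * flat j.+1 t + flat j.+2 t).
Proof.
have [t0|t0|->] := ltgtP t 0.
- rewrite !flat_le0 ?ltW// mulr0 addr0.
  apply: (@near_eq_is_derive _ _ _ (cst 0)) => //.
  near=> s; rewrite flat_le0// ltW//; near: s.
  exact: lt_nbhsl.
- have tV : is_derive t 1 (fun s : R => s^-1) (- t ^- 2).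
    by apply: is_derive_eq; [apply: is_deriveV; rewrite gt_eqF|rewrite [_ *: _]mulr1].
  have tE : is_derive t 1 (expR \o (fun s : R => - s^-1)) (expR (- t^-1) * t ^- 2).
    apply: is_derive1_comp.
    by apply: is_derive_eq; rewrite opprK.
  apply: (@near_eq_is_derive _ _ _
    ((fun s : R => s^-1) ^+ j * (expR \o (fun s : R => - s^-1)))).
    near=> s; rewrite /flat ifT; last by near: s; exact: lt_nbhsr.
    by rewrite fctE/=; congr (_ * _); rewrite fctE.
  apply: is_derive_eq.
  rewrite /flat t0 fctE/= /GRing.scale/=.
  rewrite -!exprVn; set E := expR _; set u := t^-1.
  by case: j => [|j]; rewrite ?mulr0n /= ?exprS; ring.
rewrite !flat_le0// mulr0 addr0.
(* At 0 the difference quotient of [flat j] is [flat j.+1], which tends to 0 by [flat_bound]. *)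
have quot : (fun h : R => h^-1 *: ((flat j \o shift 0) (h *: 1) - flat j 0)) @ 0^' --> (0 : R).
  rewrite (_ : (fun _ => _) = flat j.+1); last first.
    apply/funext => h /=; rewrite [flat j 0]flat_le0// subr0 addr0 [h *: 1]mulr1.
    have [h0|h0] := leP h 0; first by rewrite !flat_le0// scaler0.
    by rewrite /flat h0 exprS -mulrA.
  apply/cvgr0Pnorm_lt => eps eps0; near=> h.
  rewrite (le_lt_trans (flat_bound _ _))// mulrC -ltr_pdivlMr ?ltr0n ?fact_gt0//.
  by near: h; apply: dnbhs0_lt; rewrite divr_gt0// ltr0n fact_gt0.
by split; [apply/cvg_ex; exists 0|exact: cvg_lim quot].
Unshelve. all: by end_near.
Qed.

End flat.

Section smooth_expressions.
Context (R : realType) (n : nat).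
Local Notation V := 'rV[R]_n.

(* A class of explicit functions closed under partial derivatives, so that smoothness
   reduces to one differentiation step. *)
Inductive expr :=
| Cst of R
| Var of 'I_n
| Add of expr & expr
| Mul of expr & expr
| Flat of nat & expr
| Sin of expr
| Cos of expr.

Fixpoint eval (a : expr) (x : V) : R :=
  match a with
  | Cst c => c
  | Var i => x ord0 i
  | Add a b => eval a x + eval b x
  | Mul a b => eval a x * eval b x
  | Flat j a => flat j (eval a x)
  | Sin a => sin (eval a x)
  | Cos a => cos (eval a x)
  end.

Fixpoint diff_expr (i : 'I_n) (a : expr) : expr :=
  match a with
  | Cst _ => Cst 0
  | Var j => Cst (i == j)%:R
  | Add a b => Add (diff_expr i a) (diff_expr i b)
  | Mul a b => Add (Mul a (diff_expr i b)) (Mul b (diff_expr i a))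
  | Flat j a =>
      Mul (Add (Mul (Cst (- j%:R)) (Flat j.+1 a)) (Flat j.+2 a)) (diff_expr i a)
  | Sin a => Mul (Cos a) (diff_expr i a)
  | Cos a => Mul (Mul (Cst (-1)) (Sin a)) (diff_expr i a)
  end.

Lemma is_derive_coord (x : V) (i j : 'I_n) :
  is_derive x (basis_vec R i) (fun y : V => y ord0 j) (i == j)%:R.
Proof.
apply/is_derive_lineP.
rewrite (_ : (fun _ => _) = (i == j)%:R \*: (@id R) + cst (x ord0 j)).
  by apply: is_derive_eq; rewrite addr0 [_ *: _]mulr1.
by apply/funext => h; rewrite !mxE eqxx /= fctE /= mulrC eq_sym.
Qed.

Lemma is_derive_eval a (x : V) i :
  is_derive x (basis_vec R i) (eval a) (eval (diff_expr i a) x).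
Proof.
elim: a => [c|j|a IHa b IHb|a IHa b IHb|j a IHa|a IHa|a IHa] /=.
- exact: is_derive_cst.
- exact: is_derive_coord.
- exact: is_deriveD.
- exact: is_deriveM.
- exact: (is_derive_comp (is_derive_flat j _) IHa).
- exact: (is_derive_comp (is_derive_sin _) IHa).
- rewrite mulN1r; exact: (is_derive_comp (is_derive_cos _) IHa).
Qed.

Lemma continuous_flat j : continuous (@flat R j).
Proof.
move=> t; apply: differentiable_continuous; apply/derivable1_diffP.
exact: (@ex_derive _ _ _ _ _ _ _ (is_derive_flat j t)).
Qed.

Lemma continuous_eval a : continuous (eval a).
Proof.
elim: a => [c|j|a IHa b IHb|a IHa b IHb|j a IHa|a IHa|a IHa] x /=.
- exact: cst_continuous.
- exact: coord_continuous.
- exact: (cvgD (IHa x) (IHb x)).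
- exact: (cvgM (IHa x) (IHb x)).
- exact: (continuous_comp (IHa x) (@continuous_flat j _)).
- exact: (continuous_comp (IHa x) (@continuous_sin _ _)).
- exact: (continuous_comp (IHa x) (@continuous_cos _ _)).
Qed.

Lemma partial_eval i a : partial i (eval a) = eval (diff_expr i a).
Proof. by apply/funext => x; exact: (@derive_val _ _ _ _ _ _ _ (is_derive_eval a x i)). Qed.

Lemma smooth_eval a : smooth (eval a).
Proof.
move=> s; have -> : foldr (@partial R n) (eval a) s = eval (foldr diff_expr a s).
  by elim: s => //= i s ->; exact: partial_eval.
split; first exact: continuous_eval.
by move=> i x; exact: (@ex_derive _ _ _ _ _ _ _ (is_derive_eval _ x i)).
Qed.

Lemma continuous_measurable_rV (u : V -> R) :
  continuous u -> measurable_fun [set: V] (u : V -> measurableTypeR R).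
Proof.
move=> /continuousP cu; apply: (measurability _ (measurable_realfun.RGenOpens.measurableE R)).
move=> _ [_ [a [b ->] <-]]; rewrite setTI; apply: open_measurable_rV.
by apply: cu; exact: interval_open.
Qed.

End smooth_expressions.

(** * Integration of partial derivatives *)

Section finite_support.
Context d (T : measurableType d) (R : realType).
Context (mu : {measure set T -> \bar R}).

Lemma integrable_bounded_supp (A : set T) (f : T -> R) (C : R) :
  measurable A -> (mu A < +oo)%E -> measurable_fun [set: T] (f : T -> measurableTypeR R) ->
  (forall x, `|f x| <= C) -> (forall x, ~ A x -> f x = 0) ->
  mu.-integrable [set: T] (EFin \o f).
Proof.
move=> mA Afin mf fC f0.
have -> : EFin \o f = (EFin \o f) \_ A.
  apply/funext => x; rewrite patchE; case: ifPn => // /negP; rewrite inE => xA.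
  by rewrite /= f0.
apply: ((integrable_mkcond (EFin \o f) mA).1).
apply: (@measurable_bounded_integrable _ _ _ mu f A mA Afin).
  exact: measurable_funTS.
by exists C; split; [exact: num_real|move=> c Cc x _; apply: le_trans (fC x) (ltW Cc)].
Qed.

End finite_support.

Section integral_partial.
Context (R : realType).

Definition cube n (M : R) : set 'rV[R]_n := [set x | forall i, `[- M, M]%classic (x ord0 i)].

Lemma measurable_cube n M : measurable (@cube n M).
Proof. by apply: (@measurable_box R n (fun=> _)) => i; exact: measurable_itv. Qed.

Lemma cubeP n M (x : 'rV[R]_n) : cube M x <-> forall i, `|x ord0 i| <= M.
Proof. by split => h i; have := h i; rewrite /= in_itv/= ler_norml. Qed.

Lemma lebesgue_cube n M : 0 <= M ->
  lebesgue_rV R n (@cube n M) = ((2 * M) ^+ n)%:E.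
Proof.
move=> M0; rewrite (@lebesgue_rV_box R n (fun=> `[- M, M]%classic)) => [|i]; last first.
  exact: measurable_itv.
rewrite big_const_ord.
have -> : lebesgue_measure `[- M, M]%classic = (2 * M)%:E.
  rewrite lebesgue_measure_itv/= lte_fin; case: ltP => h; last by congr EFin; lra.
  by rewrite -EFinD; congr EFin; ring.
by elim: n => [|n IH] //=; rewrite IH -EFinM exprS.
Qed.

Lemma consrV_basis0 n (x t : R) (v : 'rV[R]_n) :
  consrV (x, v) + t *: basis_vec R (ord0 : 'I_n.+1) = consrV (x + t, v).
Proof.
apply/rowP => j; rewrite mxE; case: (unliftP ord0 j) => [l|] ->.
  by rewrite !consrVS !mxE eqxx mulr0 addr0.
by rewrite !consrV0 !mxE !eqxx mulr1.
Qed.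

Lemma consrV_basisS n (x t : R) (v : 'rV[R]_n) i :
  consrV (x, v) + t *: basis_vec R (lift ord0 i) = consrV (x, v + t *: basis_vec R i).
Proof.
apply/rowP => j; rewrite mxE; case: (unliftP ord0 j) => [l|] ->.
  by rewrite !consrVS !mxE eqxx (inj_eq lift_inj).
by rewrite !consrV0 !mxE eqxx mulr0 addr0.
Qed.

(** The fundamental theorem of calculus on an interval whose ends lie beyond the support. *)
Lemma integral_derive0 (g g' : R -> R) M : (forall t : R, is_derive t 1 g (g' t)) ->
  continuous g' -> (forall t, M < `|t| -> g t = 0 /\ g' t = 0) ->
  (\int[lebesgue_measure]_t (g' t)%:E = 0)%E.
Proof.
move=> dg cg' supp; pose K := `|M| + 1.
have MK : M < `|K| by rewrite ger0_norm ?addr_ge0// ltr_pwDr// ler_norm.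
have K0 : - K < K by rewrite gtrN// /K ltr_pwDr.
have cg : continuous g.
  move=> t; apply: differentiable_continuous; apply/derivable1_diffP.
  exact: (@ex_derive _ _ _ _ _ _ _ (dg t)).
transitivity (\int[lebesgue_measure]_(t in `[(- K)%R, K]) (g' t)%:E)%E.
  rewrite [RHS]integral_mkcond; apply: eq_integral => t _.
  rewrite patchE; case: ifPn => // /negP; rewrite inE/= in_itv/= -ler_norml => /negP.
  rewrite -ltNge => tK; rewrite (supp t _).2// (le_lt_trans _ tK)//.
  by rewrite (le_trans (ler_norm _))// lerDl.
rewrite (@continuous_FTC2 _ _ g)//.
- by rewrite (supp K MK).1 (supp (- K) _).1 ?normrN// subee.
- exact: continuous_subspaceT.
- split=> [t _||]; first exact: (@ex_derive _ _ _ _ _ _ _ (dg t)).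
    exact: cvg_at_right_filter (cg _).
  exact: cvg_at_left_filter (cg _).
- move=> t _; rewrite derive1E; exact: (@derive_val _ _ _ _ _ _ _ (dg t)).
Qed.

(** Fubini and induction on the dimension. If [i] is the first coordinate, that variable is
    integrated first, on each line; otherwise the induction hypothesis applies on each slice. *)
Lemma integral_partial0 n (i : 'I_n) (M C : R) (g g' : 'rV[R]_n -> R) :
  measurable_fun [set: 'rV[R]_n] (g' : _ -> measurableTypeR R) ->
  (forall x, `|g' x| <= C) ->
  (forall x, ~ cube M x -> g x = 0 /\ g' x = 0) ->
  (forall x, is_derive x (basis_vec R i) g (g' x)) ->
  (forall x, continuous (fun t : R => g' (x + t *: basis_vec R i))) ->
  (\int[lebesgue_rV R n]_x (g' x)%:E = 0)%E.
Proof.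
elim: n i g g' => [[]//|n IH] i g g' mg' g'C supp dg cg'.
have mgc : measurable_fun setT (g' \o @consrV R n).
  by apply: measurableT_comp => //; exact: measurable_consrV.
have mcube : measurable (@consrV R n @^-1` cube M).
  rewrite -[X in measurable X]setTI; apply: measurable_consrV => //.
  exact: measurable_cube.
(* [M] may be negative, while [lebesgue_cube] asks for a nonnegative half-width. *)
have M1 : 0 <= Num.max M 0 by rewrite le_max lexx orbT.
have cubefin : ((lebesgue_measure \x lebesgue_rV R n)%E (@consrV R n @^-1` cube M) < +oo)%E.
  apply: (@le_lt_trans _ _ (lebesgue_rV R n.+1 (cube (Num.max M 0)))).
    rewrite -[X in (X <= _)%E]/(lebesgue_rV R n.+1 (cube M)).
    apply: le_measure; rewrite ?inE; [exact: measurable_cube|exact: measurable_cube|].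
    by move=> x /cubeP h; apply/cubeP => j; rewrite le_max h.
  by rewrite lebesgue_cube// ltry.
have int : (lebesgue_measure \x lebesgue_rV R n)%E.-integrable setT
    (EFin \o (g' \o @consrV R n)).
  apply: (integrable_bounded_supp mcube cubefin mgc (C := C)).
    by move=> x; exact: g'C.
  by move=> x /supp[].
transitivity (\int[(lebesgue_measure \x lebesgue_rV R n)%E]_x
    ((EFin \o (g' \o @consrV R n)) x))%E.
  rewrite -[LHS]/(\int[pushforward (lebesgue_measure \x lebesgue_rV R n)%E
    (@consrV R n)]_(x in setT) (EFin \o g') x)%E.
  rewrite integral_pushforward//; first exact: measurable_consrV.
  exact/measurable_EFinP.
case: (unliftP ord0 i) => [j|] iE.
  rewrite -integral12_prod_meas1// integral0_eq// => x _.
  apply: (IH j (g \o (fun v => consrV (x, v))) (g' \o (fun v => consrV (x, v)))).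
  - exact: (measurableT_comp mgc (pair1_measurable x)).
  - by move=> v; exact: g'C.
  - move=> v vM; apply: supp => /cubeP xv; apply: vM; apply/cubeP => l.
    by have := xv (lift ord0 l); rewrite consrVS.
  - move=> v; apply/is_derive_lineP.
    have /is_derive_lineP := dg (consrV (x, v)); rewrite iE.
    congr (is_derive _ _ _ _); apply/funext => h /=.
    by rewrite ![h *: _ + _]addrC consrV_basisS.
  - move=> v; have -> : (fun t : R => (g' \o (fun v => consrV (x, v)))
        (v + t *: basis_vec R j)) = fun t => g' (consrV (x, v) + t *: basis_vec R i).
      by apply/funext => t; rewrite iE consrV_basisS.
    exact: cg'.
rewrite -integral21_prod_meas1// integral0_eq// => v _.
have lineE (h : 'rV[R]_n.+1 -> R) :
    (fun t => h (consrV (0, v) + t *: basis_vec R i)) = fun t => h (consrV (t, v)).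
  by apply/funext => t; rewrite iE consrV_basis0 add0r.
apply: (@integral_derive0 (fun t => g (consrV (t, v))) (fun t => g' (consrV (t, v))) M).
- move=> t; rewrite -[X in is_derive _ _ X]lineE.
  rewrite -[g' _]/((fun t => g' (consrV (t, v))) t) -lineE.
  exact: is_derive_line.
- rewrite -lineE; exact: cg'.
- move=> t tM; apply: supp => /cubeP xv.
  by have := xv ord0; rewrite consrV0 leNgt tM.
Qed.

End integral_partial.

(** * Test functions as Sobolev functions *)

Section test_functions.
Context (R : realType) (n : nat).
Local Notation V := 'rV[R]_n.
Local Notation vol := (lebesgue_rV R n).
Implicit Types (Omega S : set V) (u phi : V -> R).

Lemma coord_le_norm (x : V) j : `|x ord0 j| <= `|x|.
Proof.
by rewrite [leRHS]mx_normrE; exact: (le_bigmax _ (fun ij => `|x ij.1 ij.2|) (ord0, j)).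
Qed.

Lemma compact_sub_cube S : compact S -> exists M, S `<=` cube M.
Proof.
move=> /compact_bounded[M [_ SM]]; exists (M + 1) => x Sx; apply/cubeP => j.
rewrite (le_trans (coord_le_norm x j))//; apply: SM Sx.
by rewrite ltrDl.
Qed.

Lemma compact_supp_bounded S u : compact S -> continuous u ->
  (forall x, ~ S x -> u x = 0) -> exists C, forall x, `|u x| <= C.
Proof.
move=> cS cu u0.
have /compact_bounded[C [_ uC]] : compact (u @` S).
  by apply: continuous_compact => //; exact: continuous_subspaceT.
exists (`|C| + 1) => x; have [Sx|/u0 ->] := pselect (S x); last first.
  by rewrite normr0 addr_ge0.
by apply: (uC (`|C| + 1)); [rewrite ltr_pwDr// ler_norm|exists x].
Qed.

Definition supp phi := closure [set x | phi x != 0].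

Lemma supp_out phi x : ~ supp phi x -> \near x, phi x = 0.
Proof.
move=> /existsNP[A /not_implyP[Ax /nonemptyPn A0]].
apply: filterS Ax => y Ay; apply: contrapT => /eqP phiy.
by have : [set x | phi x != 0] `&` A = set0 by []; rewrite -subset0 => /(_ y); apply.
Qed.

Lemma supp_out0 phi x : ~ supp phi x -> phi x = 0.
Proof. by move=> /supp_out/nbhs_singleton. Qed.

Lemma partial_out phi i x : ~ supp phi x -> partial i phi x = 0.
Proof.
move=> /supp_out phi0; rewrite /partial (near_eq_derive (g := cst 0))//.
exact: derive_cst.
Qed.

Lemma smooth_continuous phi : smooth phi -> continuous phi.
Proof. by move=> /(_ [::])[]. Qed.

Lemma smooth_partial_continuous phi i : smooth phi -> continuous (partial i phi).
Proof. by move=> /(_ [:: i])[]. Qed.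

Lemma smooth_is_derive phi i x : smooth phi ->
  is_derive x (basis_vec R i) phi (partial i phi x).
Proof. by move=> /(_ [::])[_ /(_ i x) d]; split. Qed.

Lemma integral_supp Omega (f : V -> R) : (forall x, ~ Omega x -> f x = 0) ->
  (\int[vol]_(x in Omega) (f x)%:E = \int[vol]_x (f x)%:E)%E.
Proof.
move=> f0; rewrite integral_mkcond; apply: eq_integral => x _.
by rewrite patchE; case: ifPn => // /negP; rewrite inE => /f0 ->.
Qed.

Lemma integrable_compact_supp S u : compact S -> continuous u ->
  (forall x, ~ S x -> u x = 0) -> vol.-integrable [set: V] (EFin \o u).
Proof.
move=> cS cu u0; have [M SM] := compact_sub_cube cS.
have [C uC] := compact_supp_bounded cS cu u0.
apply: (@integrable_bounded_supp _ _ _ vol (cube (Num.max M 0)) u C) => //.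
- exact: measurable_cube.
- rewrite -[X in (X < _)%E]/(lebesgue_rV R n (cube (Num.max M 0))).
  by rewrite lebesgue_cube ?ltry// le_max lexx orbT.
- exact: continuous_measurable_rV.
- move=> x xM; apply: u0 => /SM/cubeP h; apply: xM; apply/cubeP => i.
  by rewrite le_max h.
Qed.

Lemma Lfun_compact_supp S u : compact S -> continuous u ->
  (forall x, ~ S x -> u x = 0) -> u \in Lfun vol 1%E /\ u \in Lfun vol +oo%E.
Proof.
move=> cS cu u0; have mu := continuous_measurable_rV cu.
have [C uC] := compact_supp_bounded cS cu u0.
split; first exact/Lfun1_integrable/(integrable_compact_supp cS cu u0).
rewrite inE; apply/andP; split; rewrite inE//=.
rewrite /finite_norm unlock/=; case: ifPn => _; last by rewrite ltry.
apply: (@le_lt_trans _ _ C%:E); last by rewrite ltry.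
by apply/ess_supP; apply: aeW => x /=; rewrite lee_fin uC.
Qed.

Lemma integral_partial_supp S (u : V -> R) i : compact S ->
  (forall x, is_derive x (basis_vec R i) u (partial i u x)) ->
  continuous (partial i u) -> (forall x, ~ S x -> u x = 0 /\ partial i u x = 0) ->
  (\int[vol]_x (partial i u x)%:E = 0)%E.
Proof.
move=> cS du cu u0; have [M SM] := compact_sub_cube cS.
have [C uC] := compact_supp_bounded cS cu (fun x Sx => (u0 x Sx).2).
apply: (@integral_partial0 _ _ i M C u (partial i u)) => //.
- exact: continuous_measurable_rV.
- by move=> x xM; apply: u0 => /SM.
- move=> x t; apply: (@continuous_comp _ _ _ (fun t : R => x + t *: basis_vec R i));
    last exact: cu.
  by apply: cvgD; [exact: cvg_cst|apply: cvgZr_tmp; exact: cvg_id].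
Qed.

(** Integration by parts: the partial derivative of u phi is compactly supported and has integral
    0. *)
Lemma weak_gradient_test Omega u : test_fun Omega u ->
  weak_gradient Omega u (fun i => partial i u).
Proof.
move=> [su cSu Suo] phi [sphi cphi phiO] i.
have u0 x : ~ supp u x -> u x = 0 by exact: supp_out0.
have cu := smooth_continuous su; have cphi' := smooth_continuous sphi.
have cdu := smooth_partial_continuous (i := i) su.
have cdphi := smooth_partial_continuous (i := i) sphi.
rewrite (@integral_supp Omega (fun x => u x * partial i phi x)); last first.
  by move=> x xO; rewrite supp_out0 ?mul0r// => /Suo.
rewrite (@integral_supp Omega (fun x => partial i u x * phi x)); last first.
  by move=> x xO; rewrite partial_out ?mul0r// => /Suo.
have dM x : is_derive x (basis_vec R i) (u * phi)
    (u x * partial i phi x + partial i u x * phi x).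
  rewrite [X in _ + X]mulrC; apply: is_deriveM; exact: smooth_is_derive.
have pM : partial i (u * phi) = fun x => u x * partial i phi x + partial i u x * phi x.
  by apply/funext => x; exact: (@derive_val _ _ _ _ _ _ _ (dM x)).
have c1 : continuous (fun x => u x * partial i phi x).
  by move=> x; exact: (cvgM (cu x) (cdphi x)).
have c2 : continuous (fun x => partial i u x * phi x).
  by move=> x; exact: (cvgM (cdu x) (cphi' x)).
have z1 x : ~ supp u x -> u x * partial i phi x = 0 by move=> /u0 ->; rewrite mul0r.
have z2 x : ~ supp u x -> partial i u x * phi x = 0.
  by move=> /partial_out ->; rewrite mul0r.
have i1 := integrable_compact_supp cSu c1 z1.
have i2 := integrable_compact_supp cSu c2 z2.
have := @integral_partial_supp (supp u) (u * phi) i cSu.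
rewrite pM => /(_ dM) H.
have {}H := H (fun x => cvgD (c1 x) (c2 x)).
have : (\int[vol]_x (u x * partial i phi x + partial i u x * phi x)%:E = 0)%E.
  by apply: H => x xS; rewrite z1// z2// addr0 fctE u0// mul0r.
under eq_integral do rewrite EFinD.
rewrite integralD//=.
have /fineK <- := integrable_fin_num measurableT i1.
have /fineK <- := integrable_fin_num measurableT i2.
by move=> [] /eqP; rewrite addr_eq0 => /eqP ->.
Qed.

(** The approximating sequence is constantly [u]. *)
Lemma test_fun_W1_0_oo Omega u : open Omega -> test_fun Omega u ->
  W1_0_oo Omega u (fun i => partial i u).
Proof.
move=> oO tu; have [su cSu SuO] := tu.
have uO : u \_ Omega = u.
  apply/funext => x; rewrite patchE; case: ifPn => // /negP; rewrite inE => xO.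
  by rewrite supp_out0// => /SuO.
have duO i : partial i u \_ Omega = partial i u.
  apply/funext => x; rewrite patchE; case: ifPn => // /negP; rewrite inE => xO.
  by rewrite partial_out// => /SuO.
have [L1 Loo] := Lfun_compact_supp cSu (smooth_continuous su) (@supp_out0 u).
have dL i := Lfun_compact_supp cSu (smooth_partial_continuous (i := i) su)
  (@partial_out u i).
have wg := weak_gradient_test tu.
split; split; rewrite ?uO//; try by [].
- by move=> i; rewrite duO; have [] := dL i.
- by split; rewrite ?uO// => i; rewrite duO; have [] := dL i.
exists (fun=> u); split => // [|i].
- under eq_fun do under eq_integral do rewrite subrr normr0.
  by rewrite integral0; exact: cvg_cst.
- under eq_fun do under eq_integral do rewrite subrr normr0.
  by rewrite integral0; exact: cvg_cst.
Qed.

End test_functions.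

(** * Cutoff *)

Section cutoff.
Context (R : realType) (n : nat).
Local Notation V := 'rV[R]_n.
Local Notation vol := (lebesgue_rV R n).

(** Positive exactly for |x_i| < 1, so that the product over [i] vanishes outside [cube 1]. *)
Definition bump_factor (i : 'I_n) : expr R n :=
  Flat 0 (Add (Cst n 1) (Mul (Cst n (-1)) (Mul (Var R i) (Var R i)))).

Definition bump : expr R n :=
  foldr (fun i a => Mul (bump_factor i) a) (Cst n 1) (enum 'I_n).

Lemma eval_bump (x : V) : eval bump x = \prod_i flat 0 (1 - x ord0 i ^+ 2).
Proof.
rewrite /bump -big_enum/=; elim: (enum _) => [|i s IH]; first by rewrite big_nil.
by rewrite big_cons /= IH mulN1r expr2.
Qed.

Lemma bump_ge0 (x : V) : 0 <= eval bump x.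
Proof. by rewrite eval_bump prodr_ge0// => i _; exact: flat_ge0. Qed.

Lemma bump0_gt0 : 0 < eval bump 0.
Proof.
rewrite eval_bump; apply: prodr_gt0 => i _; apply: flat_gt0.
by rewrite mxE expr0n/= subr0.
Qed.

Lemma bump_out (x : V) : ~ cube 1 x -> eval bump x = 0.
Proof.
move=> xc; have /existsNP[i xi] : ~ forall i, `|x ord0 i| <= 1 by move/cubeP.
rewrite eval_bump (bigD1 i)//= flat_le0 ?mul0r// subr_le0.
move/negP : xi; rewrite -ltNge => /ltW xi.
by rewrite -[leRHS]real_normK ?num_real// exprn_ege1.
Qed.

Lemma compact_cube (M : R) : compact (@cube R n M).
Proof.
by apply: (@rV_compact _ _ (fun=> `[- M, M]%classic)) => i; exact: segment_compact.
Qed.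

Lemma closed_cube (M : R) : closed (@cube R n M).
Proof. by apply: compact_closed; [exact: norm_hausdorff|exact: compact_cube]. Qed.

(** The domain Omega of the counterexample: an open sup-norm ball containing [cube 1], outside which
    the cutoff vanishes. *)
Definition box2 : set V := ball (0 : V) 2.

Lemma open_box2 : open box2. Proof. exact: ball_open. Qed.

Lemma box2P (x : V) : box2 x <-> forall i, `|x ord0 i| < 2.
Proof.
split=> [[_ h] i|h]; first by have := h ord0 i; rewrite /ball/= mxE sub0r normrN.
by split => // i j; rewrite /ball/= mxE sub0r normrN ord1.
Qed.

Lemma cube1_box2 : cube 1 `<=` box2.
Proof.
by move=> x /cubeP h; apply/box2P => i; rewrite (le_lt_trans (h i))// ltr1n.
Qed.

Lemma box2_cube2 : box2 `<=` cube 2.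
Proof. by move=> x /box2P h; apply/cubeP => i; exact: ltW. Qed.

Lemma bounded_box2 : bounded_set box2.
Proof.
have [M [Mr cM]] := compact_bounded (@compact_cube 2).
by exists M; split => // c Mc x /box2_cube2; exact: cM.
Qed.

Lemma vol_box2 : (vol box2 < +oo)%E.
Proof.
apply: (@le_lt_trans _ _ (lebesgue_rV R n (cube 2))).
  apply: le_measure box2_cube2; rewrite inE; last exact: measurable_cube.
  by apply: open_measurable_rV; exact: open_box2.
by rewrite lebesgue_cube// ltry.
Qed.

Lemma supp_cube (u : V -> R) : (forall x, ~ cube 1 x -> u x = 0) -> supp u `<=` cube 1.
Proof.
move=> u0 x; rewrite /supp; have /closure_id -> := @closed_cube 1.
apply: closureS => y /= /eqP uy; apply: contrapT => yc; exact/uy/u0.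
Qed.

Lemma test_fun_eval (a : expr R n) : (forall x, ~ cube 1 x -> eval a x = 0) ->
  test_fun box2 (eval a).
Proof.
move=> a0; split; first exact: smooth_eval.
  apply: (subclosed_compact _ (@compact_cube 1)); first exact: closed_closure.
  exact: supp_cube.
by move=> x /(supp_cube a0)/cube1_box2.
Qed.

Lemma diff_expr_out (a : expr R n) i : (forall x, ~ cube 1 x -> eval a x = 0) ->
  forall x, ~ cube 1 x -> eval (diff_expr i a) x = 0.
Proof.
move=> a0 x xc; rewrite -partial_eval; apply: partial_out.
by move/(supp_cube a0).
Qed.

Lemma eval_bounded (a : expr R n) : (forall x, ~ cube 1 x -> eval a x = 0) ->
  exists2 C, 0 <= C & forall x, `|eval a x| <= C.
Proof.
move=> a0; have [C aC] := compact_supp_bounded (@compact_cube 1)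
  (@continuous_eval _ _ a) a0.
by exists C => //; exact: le_trans (aC 0).
Qed.

Lemma integral_diff_expr (a : expr R n) i : (forall x, ~ cube 1 x -> eval a x = 0) ->
  (\int[vol]_x (eval (diff_expr i a) x)%:E = 0)%E.
Proof.
move=> a0; rewrite -partial_eval; apply: (integral_partial_supp (@compact_cube 1)).
- by move=> x; rewrite partial_eval; exact: is_derive_eval.
- by rewrite partial_eval; exact: continuous_eval.
- by move=> x xc; rewrite a0// partial_eval diff_expr_out.
Qed.

Lemma integrable_eval (a : expr R n) : (forall x, ~ cube 1 x -> eval a x = 0) ->
  vol.-integrable [set: V] (EFin \o eval a).
Proof.
move=> a0; apply: (integrable_compact_supp (@compact_cube 1)) => //.
exact: continuous_eval.
Qed.

(** By continuity the function exceeds half its value at 0 on a small cube of positive volume. *)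
Lemma integral_eval_gt0 (a : expr R n) : (forall x, 0 <= eval a x) -> 0 < eval a 0 ->
  (0 < \int[vol]_x (eval a x)%:E)%E.
Proof.
move=> a0 a00; pose c := eval a 0 / 2.
have c0 : 0 < c by rewrite divr_gt0.
have : \forall x \near (0 : V), c < eval a x.
  have := @continuous_eval _ _ a 0; move/cvgr_gt; apply.
  by rewrite /c ltr_pdivrMr// ltr_pMr// ltr1n.
move=> /nbhs_ballP[d /= d0 dc].
have d20 : 0 < d / 2 by rewrite divr_gt0.
have cubed : cube (d / 2) `<=` ball (0 : V) d.
  move=> x /cubeP h; split => // i j; rewrite /ball/= mxE sub0r normrN ord1.
  by rewrite (le_lt_trans (h j))// ltr_pdivrMr// ltr_pMr// ltr1n.
have mc : measurable (@cube R n (d / 2)) by exact: measurable_cube.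
apply: (@lt_le_trans _ _ (\int[vol]_(x in cube (d / 2)) c%:E)%E).
  rewrite integral_cst//= lebesgue_cube ?ltW// -EFinM lte_fin mulr_gt0//.
  by rewrite exprn_gt0// mulr_gt0.
apply: (@le_trans _ _ (\int[vol]_(x in cube (d / 2)) (eval a x)%:E)%E).
  apply: ge0_le_integral => //.
  - by move=> x _; rewrite lee_fin ltW.
  - apply/measurable_EFinP/measurable_funTS; apply: continuous_measurable_rV.
    exact: continuous_eval.
  - by move=> x /cubed/dc/ltW; rewrite lee_fin.
apply: ge0_subset_integral => //.
  apply/measurable_EFinP; apply: continuous_measurable_rV; exact: continuous_eval.
by move=> x _; rewrite lee_fin.
Qed.

End cutoff.

(** * The competitor *)

Section norm_bounds.
Context (R : realType) (n k : nat).
Implicit Types w : altform R n k.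

Lemma coef_le_norm w I : `|coef w I| <= alt_norm w.
Proof.
rewrite coefE /alt_norm (bigD1 (finfun I))//= lerDl.
by apply: sumr_ge0 => J _; exact: normr_ge0.
Qed.

Lemma alt_norm_ge0 w : 0 <= alt_norm w.
Proof. by apply: sumr_ge0 => J _; exact: normr_ge0. Qed.

Lemma sqn_le_norm w : sqn w <= alt_norm w ^+ 2.
Proof.
have -> : alt_norm w ^+ 2 = \sum_I `|alt_coef w I| * alt_norm w.
  by rewrite -mulr_suml expr2.
apply: ler_sum => I _.
rewrite -real_normK ?num_real// expr2 ler_wpM2l//.
rewrite /alt_norm (bigD1 I)//= lerDl.
by apply: sumr_ge0 => J _; exact: normr_ge0.
Qed.

Lemma sqnZ a w : sqn (a *: w) = a ^+ 2 * sqn w.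
Proof.
rewrite /sqn mulr_sumr; apply: eq_bigr => I _.
by rewrite -exprMn.
Qed.

Lemma sqn0 : sqn (0 : altform R n k) = 0.
Proof. by have := sqnZ 0 0; rewrite scaler0 expr0n/= mul0r. Qed.

Lemma alt_norm0 : alt_norm (0 : altform R n k) = 0.
Proof. by have := alt_normZ 0 (0 : altform R n k); rewrite scaler0 normr0 mul0r. Qed.

Lemma alt_norm_sum (T : Type) (r : seq T) (F : T -> altform R n k) :
  alt_norm (\sum_(i <- r) F i) <= \sum_(i <- r) alt_norm (F i).
Proof.
elim: r => [|i r IH]; first by rewrite !big_nil alt_norm0.
by rewrite !big_cons (le_trans (alt_normD _ _))// lerD2l.
Qed.

End norm_bounds.

Section integrand_bound.
Context (R : realType) (n' q : nat).
Hypotheses (hq : (0 < q)%N) (hn : (q.+3 <= n')%N).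
Local Notation n := n'.+1.
Variable e : (1 + q = q.+1)%N.
Local Notation plane := (@plane R n' q e).
Implicit Types (r s t : R) (xi : altform R n q.+1).

Lemma plane_split r s t :
  plane r s t = r *: plane 1 0 0 + (s *: plane 0 1 0 + t *: plane 0 0 1).
Proof.
have p0 : plane 0 0 0 = 0.
  by have := @plane_linear R n' q e (-1) 0 0 0 0 0 0; rewrite !mulr0 !addr0 scaleN1r addNr.
rewrite -[t *: _]addr0 -p0 -!plane_linear.
by congr plane; ring.
Qed.

Definition plane_norm : R :=
  alt_norm (plane 1 0 0) + (alt_norm (plane 0 1 0) + alt_norm (plane 0 0 1)).

Lemma alt_norm_plane r s t (C : R) : `|r| <= C -> `|s| <= C -> `|t| <= C ->
  alt_norm (plane r s t) <= C * plane_norm.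
Proof.
move=> rC sC tC; rewrite plane_split.
rewrite (le_trans (alt_normD _ _))// /plane_norm mulrDr lerD//.
  by rewrite alt_normZ ler_wpM2r// alt_norm_ge0.
rewrite (le_trans (alt_normD _ _))// mulrDr lerD// alt_normZ ler_wpM2r//;
  exact: alt_norm_ge0.
Qed.

Lemma plane_norm_ge0 : 0 <= plane_norm.
Proof. by rewrite /plane_norm !addr_ge0// alt_norm_ge0. Qed.

Lemma alt_norm_off xi : alt_norm (off e xi) <= alt_norm xi * (1 + plane_norm).
Proof.
rewrite /off (le_trans (alt_normD _ _))// mulrDr mulr1 lerD2l.
rewrite -scaleN1r alt_normZ normrN1 mul1r.
by apply: alt_norm_plane; exact: coef_le_norm.
Qed.

(** The factors are perturbed one at a time, each change costing at most nu Cz (C0 + Cz)^2. *)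
Lemma prod3_perturb (C0 Cz nu a b c x y z : R) :
  0 <= nu <= 1 -> `|a| <= C0 -> `|b| <= C0 -> `|c| <= C0 ->
  `|x| <= Cz -> `|y| <= Cz -> `|z| <= Cz ->
  - ((a + nu * x) * (b + nu * y) * (c + nu * z)) <=
  - (a * b * c) + nu * (3 * Cz * (C0 + Cz) ^+ 2).
Proof.
move=> /andP[nu0 nu1] aC bC cC xC yC zC.
have C00 : 0 <= C0 := le_trans (normr_ge0 _) aC.
have Cz0 : 0 <= Cz := le_trans (normr_ge0 _) xC.
have D0 : C0 <= C0 + Cz by rewrite lerDl.
have near (u v : R) : `|u| <= C0 -> `|v| <= Cz -> `|u + nu * v| <= C0 + Cz.
  move=> uC vC; rewrite (le_trans (ler_normD _ _))// lerD// normrM (ger0_norm nu0).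
  by rewrite (le_trans _ vC)// ler_piMl.
have P (u v w : R) : `|u| <= Cz -> `|v| <= C0 + Cz -> `|w| <= C0 + Cz ->
    - (u * v * w) <= Cz * (C0 + Cz) ^+ 2.
  move=> uC vC wC; rewrite (le_trans (ler_norm _))// normrN !normrM expr2 mulrA.
  by rewrite !ler_pM// ?mulr_ge0.
have h1 := P _ _ _ xC (near _ _ bC yC) (near _ _ cC zC).
have h2 := P _ _ _ yC (le_trans aC D0) (near _ _ cC zC).
have h3 := P _ _ _ zC (le_trans aC D0) (le_trans bC D0).
have -> : - ((a + nu * x) * (b + nu * y) * (c + nu * z)) = - (a * b * c) +
  nu * (- (x * (b + nu * y) * (c + nu * z)) + (- (y * a * (c + nu * z)) - z * a * b)).
  by ring.
rewrite lerD2l ler_wpM2l// (le_trans (lerD h1 (lerD h2 h3)))//.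
by rewrite le_eqVlt; apply/orP; left; apply/eqP; ring.
Qed.

(** [off] vanishes on [plane a b c], so the [gam] term sees only the perturbation and is of order
    nu^2. *)
Lemma integrand_le (eps gam C0 Cz nu a b c : R) xi :
  0 <= eps -> 0 <= gam -> 0 <= nu <= 1 ->
  `|a| <= C0 -> `|b| <= C0 -> `|c| <= C0 -> alt_norm xi <= Cz ->
  integrand e eps gam (plane a b c + nu *: xi) <=
  - (a * b * c) + nu * (3 * Cz * (C0 + Cz) ^+ 2) +
  eps * ((C0 * plane_norm + Cz) ^+ 2) ^+ 2 +
  gam * (nu ^+ 2 * (Cz * (1 + plane_norm)) ^+ 2).
Proof.
move=> eps0 gam0 nu01 aC bC cC xiC; have /andP[nu0 nu1] := nu01.
have C00 : 0 <= C0 := le_trans (normr_ge0 _) aC.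
have Cz0 : 0 <= Cz := le_trans (alt_norm_ge0 _) xiC.
have [ar as_ at_] := amp_plane hq hn e a b c.
rewrite /integrand; apply: lerD; first apply: lerD.
- rewrite -[amp_r _]/(amp_r (plane a b c) + nu * amp_r xi).
  rewrite -[amp_s _]/(amp_s (plane a b c) + nu * amp_s xi).
  rewrite -[amp_t _]/(amp_t (plane a b c) + nu * amp_t xi) ar as_ at_.
  by apply: prod3_perturb => //; apply: le_trans xiC; exact: coef_le_norm.
- rewrite ler_wpM2l// lerXn2r ?nnegrE ?sqn_ge0 ?sqr_ge0//.
  rewrite (le_trans (sqn_le_norm _))// lerXn2r ?nnegrE ?alt_norm_ge0//.
    by rewrite addr_ge0// mulr_ge0// plane_norm_ge0.
  rewrite (le_trans (alt_normD _ _))// lerD//; first exact: alt_norm_plane.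
  by rewrite alt_normZ (ger0_norm nu0) (le_trans _ xiC)// ler_piMl// alt_norm_ge0.
rewrite ler_wpM2l// addrC off_linear (off_plane hq hn) addr0 sqnZ.
rewrite ler_wpM2l ?sqr_ge0// (le_trans (sqn_le_norm _))// lerXn2r ?nnegrE ?alt_norm_ge0//.
  by rewrite mulr_ge0// addr_ge0// plane_norm_ge0.
by rewrite (le_trans (alt_norm_off _))// ler_wpM2r// addr_ge0// plane_norm_ge0.
Qed.

End integrand_bound.

Section competitor_form.
Context (R : realType) (n' q : nat).
Hypotheses (hq : (0 < q)%N) (hn : (q.+3 <= n')%N).
Local Notation n := n'.+1.
Local Notation V := 'rV[R]_n.
Variable e : (1 + q = q.+1)%N.
Local Notation x0 := (x0 n').
Local Notation x1 := (x1 n').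
Local Notation bump := (bump R n).

Definition edge_form (r s t : R) : altform R n q := edges n' q (edge_weight q r s t).

Lemma edge_form_linear a r s t r' s' t' :
  edge_form (a * r + r') (a * s + s') (a * t + t') =
  a *: edge_form r s t + edge_form r' s' t'.
Proof. by rewrite /edge_form edge_weight_linear edges_linear. Qed.

Lemma edge_form0 : edge_form 0 0 0 = 0.
Proof.
by have := edge_form_linear (-1) 0 0 0 0 0 0; rewrite !mulr0 !addr0 scaleN1r addNr.
Qed.

Lemma edge_form_split r s t : edge_form r s t =
  r *: edge_form 1 0 0 + (s *: edge_form 0 1 0 + t *: edge_form 0 0 1).
Proof.
rewrite -[t *: _]addr0 -edge_form0 -!edge_form_linear.
by congr edge_form; ring.
Qed.

Section frequency.
Variable N : R.

Definition phase0 : expr R n := Mul (Cst n N) (Var R x0).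
Definition phase1 : expr R n := Mul (Cst n N) (Var R x1).
Definition phase2 : expr R n := Add phase0 phase1.

Definition potential (a : expr R n) : expr R n := Mul (Cst n N^-1) (Mul bump (Sin a)).

Definition competitor (x : V) : altform R n q :=
  edge_form (eval (potential phase0) x) (eval (potential phase1) x)
    (eval (potential phase2) x).

Definition Dcompetitor (j : 'I_n) (x : V) : altform R n q :=
  edge_form (eval (diff_expr j (potential phase0)) x)
    (eval (diff_expr j (potential phase1)) x) (eval (diff_expr j (potential phase2)) x).

Lemma potential_out a x : ~ cube 1 x -> eval (potential a) x = 0.
Proof. by move=> xc /=; rewrite bump_out// mul0r mulr0. Qed.

Lemma comp_W1_0_oo : W1_0_oo_form (@box2 R n) competitor Dcompetitor.
Proof.
move=> I.
pose c1 := alt_coef (edge_form 1 0 0) I; pose c2 := alt_coef (edge_form 0 1 0) I.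
pose c3 := alt_coef (edge_form 0 0 1) I.
pose A := Add (Mul (Cst n c1) (potential phase0))
  (Add (Mul (Cst n c2) (potential phase1)) (Mul (Cst n c3) (potential phase2))).
have splitI r s t : alt_coef (edge_form r s t) I = r * c1 + (s * c2 + t * c3).
  by rewrite edge_form_split.
have -> : (fun x => alt_coef (competitor x) I) = eval A.
  by apply/funext => x; rewrite splitI /A /=; ring.
have -> : (fun i x => alt_coef (Dcompetitor i x) I) = (fun i => partial i (eval A)).
  by apply/funext => i; rewrite partial_eval; apply/funext => x; rewrite splitI /A /=; ring.
apply: test_fun_W1_0_oo; first exact: open_box2.
apply: test_fun_eval => x xc.
by rewrite /A /= bump_out// !(mul0r, mulr0, addr0).
Qed.

(** N times the part of the exterior derivative of [competitor] in which the cutoff is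
    differentiated. *)
Definition error (x : V) : altform R n q.+1 :=
  \sum_(j < n) eval (diff_expr j bump) x *: ext_wedge e (dx R j)
    (edge_form (sin (eval phase0 x)) (sin (eval phase1 x)) (sin (eval phase2 x))).

Lemma plane_sum (a b c : R) : plane n' e a b c = \sum_(j < n) ext_wedge e (dx R j)
  (edge_form ((j == x0)%:R * a) ((j == x1)%:R * b) ((j == x0)%:R * c + (j == x1)%:R * c)).
Proof.
rewrite (bigD1 x0)//= (bigD1 x1)/=; last by rewrite (x1_neq0 hn).
rewrite big1 ?addr0 => [|j /andP[/negPf -> /negPf ->]]; last first.
  by rewrite !mul0r addr0 edge_form0 wedge0r.
by rewrite !eqxx (x1_neq0 hn) eq_sym (x1_neq0 hn) !mul1r !mul0r addr0 add0r.
Qed.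

(** Differentiating a sine produces a factor N that cancels 1/N. The phase of the third term depends
    on both coordinates and yields (dx^p + dx^q) /\ C, so the main part is a [plane] form. *)
Lemma ext_d_comp x : N != 0 -> ext_d e Dcompetitor x =
  plane n' e (eval bump x * cos (eval phase0 x)) (eval bump x * cos (eval phase1 x))
    (eval bump x * cos (eval phase2 x)) + N^-1 *: error x.
Proof.
move=> N0; rewrite plane_sum /error scaler_sumr -big_split/=.
apply: eq_bigr => j _.
rewrite addrC scalerA -wedge_linear_r; congr (ext_wedge _ _ _).
rewrite -edge_form_linear /Dcompetitor.
by congr edge_form; rewrite /=; field.
Qed.

Lemma ext_d_comp_out x : ~ cube 1 x -> ext_d e Dcompetitor x = 0.
Proof.
move=> xc; rewrite /ext_d big1// => j _; rewrite /Dcompetitor.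
rewrite !(diff_expr_out j (@potential_out _) xc) edge_form0.
exact: wedge0r.
Qed.

Lemma continuous_sum (T : Type) (r : seq T) (F : T -> V -> R) :
  (forall i, continuous (F i)) -> continuous (fun x => \sum_(i <- r) F i x).
Proof.
move=> cF; elim: r => [|i r IH] x.
  rewrite (_ : (fun _ => _) = cst 0); first exact: cst_continuous.
  by apply/funext => y; rewrite big_nil.
rewrite (_ : (fun _ => _) = (fun y => F i y + \sum_(j <- r) F j y)).
  exact: (cvgD (cF i x) (IH x)).
by apply/funext => y; rewrite big_cons.
Qed.

Lemma continuous_ext_d_comp I : continuous (fun x => coef (ext_d e Dcompetitor x) I).
Proof.
under eq_fun do rewrite /ext_d coef_sum.
apply: continuous_sum => j.
pose c r s t := coef (ext_wedge e (dx R j) (edge_form r s t)) I.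
pose A := Add (Mul (diff_expr j (potential phase0)) (Cst n (c 1 0 0)))
  (Add (Mul (diff_expr j (potential phase1)) (Cst n (c 0 1 0)))
     (Mul (diff_expr j (potential phase2)) (Cst n (c 0 0 1)))).
rewrite (_ : (fun _ => _) = eval A); first exact: continuous_eval.
apply/funext => x; rewrite /Dcompetitor edge_form_split.
rewrite -[_ *: edge_form 0 0 1]addr0.
by rewrite !wedge_linear_r wedge0r addr0.
Qed.

Lemma continuous_integrand_comp (eps gam : R) :
  continuous (fun x => integrand e eps gam (ext_d e Dcompetitor x)).
Proof.
have cc := continuous_ext_d_comp.
have cr : continuous (fun x => amp_r (ext_d e Dcompetitor x)) := cc _.
have cs : continuous (fun x => amp_s (ext_d e Dcompetitor x)) := cc _.
have ct : continuous (fun x => amp_t (ext_d e Dcompetitor x)) := cc _.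
have csqn (z : V -> altform R n q.+1) : (forall I, continuous (fun x => coef (z x) I)) ->
    continuous (fun x => sqn (z x)).
  move=> cz; apply: continuous_sum => I x.
  have -> : (fun x => alt_coef (z x) I ^+ 2) = (fun x => coef (z x) I * coef (z x) I).
    by apply/funext => y; rewrite expr2.
  exact: (cvgM (cz I x) (cz I x)).
have coff I : continuous (fun x => coef (off e (ext_d e Dcompetitor x)) I).
  move=> x; pose c (r s t : R) := coef (plane n' e r s t) I.
  have -> : (fun x => coef (off e (ext_d e Dcompetitor x)) I) = (fun x =>
      coef (ext_d e Dcompetitor x) I - (amp_r (ext_d e Dcompetitor x) * c 1 0 0 +
       (amp_s (ext_d e Dcompetitor x) * c 0 1 0 + amp_t (ext_d e Dcompetitor x) * c 0 0 1))).
    by apply/funext => y; rewrite /off /proj coefD coefN plane_split !coefD !coefZ.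
  have cst (u : R) := @cst_continuous V R u x.
  exact: (cvgB (cc I x) (cvgD (cvgM (cr x) (cst _))
    (cvgD (cvgM (cs x) (cst _)) (cvgM (ct x) (cst _))))).
move=> x; have cst (u : R) := @cst_continuous V R u x.
have c2 := csqn _ cc x.
exact: (cvgD (cvgD (cvgN (cvgM (cvgM (cr x) (cs x)) (ct x))) (cvgM (cst eps) (cvgM c2 c2)))
  (cvgM (cst gam) (csqn _ coff x))).
Qed.

End frequency.

(** Uniform in [N], since [error] contains the sines themselves and not their derivatives. *)
Lemma error_bound : exists2 C, 0 <= C & forall N x, alt_norm (error N x) <= C.
Proof.
have /choice[C CP] : forall j, exists C, forall x, `|eval (diff_expr j bump) x| <= C.
  move=> j; have [C _ bC] := @eval_bounded _ _ (diff_expr j bump)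
    (diff_expr_out j (@bump_out R n)).
  by exists C.
pose G j r s t := alt_norm (ext_wedge e (dx R j) (edge_form r s t)).
pose K j := G j 1 0 0 + (G j 0 1 0 + G j 0 0 1).
have K0 j : 0 <= K j by rewrite !addr_ge0// alt_norm_ge0.
have C0 j : 0 <= C j := le_trans (normr_ge0 _) (CP j 0).
exists (\sum_j C j * K j) => [|N x]; first by apply: sumr_ge0 => j _; rewrite mulr_ge0.
rewrite (le_trans (alt_norm_sum _ _))//; apply: ler_sum => j _.
rewrite alt_normZ ler_pM ?alt_norm_ge0// edge_form_split.
rewrite -[_ *: edge_form 0 0 1]addr0.
rewrite !wedge_linear_r wedge0r addr0 /K.
have sinle (u : R) : `|sin u| <= 1 by rewrite ler_norml sin_geN1 sin_le1.
rewrite (le_trans (alt_normD _ _))// lerD//.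
  by rewrite alt_normZ ler_piMl ?alt_norm_ge0.
by rewrite (le_trans (alt_normD _ _))// lerD// alt_normZ ler_piMl ?alt_norm_ge0.
Qed.

End competitor_form.

(** * Averaging the oscillating product *)

Section averaging.
Context (R : realType) (n' q : nat).
Hypotheses (hq : (0 < q)%N) (hn : (q.+3 <= n')%N).
Local Notation n := n'.+1.
Local Notation V := 'rV[R]_n.
Local Notation vol := (lebesgue_rV R n).
Variable e : (1 + q = q.+1)%N.
Local Notation x0 := (x0 n').
Local Notation x1 := (x1 n').
Local Notation bump := (bump R n).

Definition bump3 : expr R n := Mul bump (Mul bump bump).

Lemma bump3_out x : ~ cube 1 x -> eval bump3 x = 0.
Proof. by move=> xc; rewrite /= bump_out// mul0r. Qed.

Section frequency.
Variable N : R.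
Local Notation dcomp := (ext_d e (@Dcompetitor R n' q N)).

(** With chi for [bump]: the derivative of chi^3 sin(2a) / (2 N) in a direction where the phase [a]
    has slope N is chi^3 cos(2a) up to O(1/N). *)
Definition osc (a : expr R n) : expr R n :=
  Mul (Cst n (2 * N)^-1) (Mul bump3 (Sin (Add a a))).

Lemma osc_out a x : ~ cube 1 x -> eval (osc a) x = 0.
Proof. by move=> xc; rewrite /= bump_out// !mul0r mulr0. Qed.

Definition flux : expr R n := Add (diff_expr x0 (osc (phase0 n' N)))
  (Add (diff_expr x1 (osc (phase1 n' N))) (diff_expr x0 (osc (phase2 n' N)))).

(** Up to O(1/N) this is the product chi^3 cos a cos b cos(a + b). As [flux] is a sum of partial
    derivatives of compactly supported functions, the integral is exactly a quarter of that of
    chi^3, so no limit of oscillating integrals has to be taken. *)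
Definition defect : expr R n := Mul (Cst n (1 / 4)) (Add bump3 flux).

Lemma flux_out x : ~ cube 1 x -> eval flux x = 0.
Proof.
move=> xc; rewrite -[LHS]/(eval (diff_expr x0 (osc (phase0 n' N))) x +
  (eval (diff_expr x1 (osc (phase1 n' N))) x + eval (diff_expr x0 (osc (phase2 n' N))) x)).
by rewrite !(diff_expr_out _ (@osc_out _) xc) !addr0.
Qed.

Lemma defect_out x : ~ cube 1 x -> eval defect x = 0.
Proof.
move=> xc; rewrite -[LHS]/(1 / 4 * (eval bump3 x + eval flux x)).
by rewrite flux_out// bump3_out// addr0 mulr0.
Qed.

Lemma cos_product (a b : R) :
  cos a * cos b * cos (a + b) =
  1 / 4 * (1 + (cos (a + a) + (cos (b + b) + cos (a + b + (a + b))))).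
Proof.
rewrite !(cosD, sinD).
have sa : sin a ^+ 2 = 1 - cos a ^+ 2 by rewrite -(cos2Dsin2 a); ring.
have sb : sin b ^+ 2 = 1 - cos b ^+ 2 by rewrite -(cos2Dsin2 b); ring.
transitivity (cos a ^+ 2 * cos b ^+ 2 - sin a * cos a * (sin b * cos b)); first by ring.
transitivity (1 / 4 * (1 + (cos a ^+ 2 - sin a ^+ 2 + (cos b ^+ 2 - sin b ^+ 2 +
  (cos a ^+ 2 * cos b ^+ 2 + sin a ^+ 2 * sin b ^+ 2
   - sin a ^+ 2 * cos b ^+ 2 - cos a ^+ 2 * sin b ^+ 2 -
   4 * (sin a * cos a * (sin b * cos b))))))); last by ring.
by rewrite sa sb; field.
Qed.

(** By [cos_product] the leading terms cancel; what is left is the sum of three terms, each at most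
    [C] in absolute value, divided by 8 N. *)
Lemma product_average (C : R) (x : V) : 0 < N ->
  (forall i, `|eval (diff_expr i bump3) x| <= C) ->
  - ((eval bump x * cos (eval (phase0 n' N) x)) *
     (eval bump x * cos (eval (phase1 n' N) x)) *
     (eval bump x * cos (eval (phase2 n' N) x))) + eval defect x <= N^-1 * C.
Proof.
move=> N0 hC; set a := eval (phase0 n' N) x; set b := eval (phase1 n' N) x.
have -> : eval (phase2 n' N) x = a + b by [].
set X := eval bump x.
have dE i (p : expr R n) : eval (diff_expr i (osc p)) x =
    N^-1 * (X ^+ 3 * cos (eval p x + eval p x) * eval (diff_expr i p) x) +
    (2 * N)^-1 * (sin (eval p x + eval p x) * eval (diff_expr i bump3) x).
  by rewrite /= -/X; field; rewrite gt_eqF.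
have -> : eval defect x = 1 / 4 * (X ^+ 3 + eval flux x) by rewrite /= -/X; ring.
rewrite -[eval flux x]/(eval (diff_expr x0 (osc (phase0 n' N))) x +
  (eval (diff_expr x1 (osc (phase1 n' N))) x + eval (diff_expr x0 (osc (phase2 n' N))) x)).
rewrite !dE.
have d0 j : eval (diff_expr j (phase0 n' N)) x = N * (j == x0)%:R.
  by rewrite -[LHS]/(N * (j == x0)%:R + x ord0 x0 * 0) mulr0 addr0.
have d1 j : eval (diff_expr j (phase1 n' N)) x = N * (j == x1)%:R.
  by rewrite -[LHS]/(N * (j == x1)%:R + x ord0 x1 * 0) mulr0 addr0.
have d2 j : eval (diff_expr j (phase2 n' N)) x = N * (j == x0)%:R + N * (j == x1)%:R.
  by rewrite -d0 -d1.
rewrite d0 d1 d2 [x0 == x1]eq_sym (x1_neq0 hn) !eqxx mulr0 addr0 mulr1.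
rewrite -/a -/b -[eval (phase2 n' N) x]/(a + b).
have tail (p : R) i : `|sin p * eval (diff_expr i bump3) x| <= C.
  rewrite normrM (le_trans _ (hC i))// ler_piMl//.
  by rewrite ler_norml sin_geN1 sin_le1.
have t0 := tail (a + a) x0; have t1 := tail (b + b) x1.
have t2 := tail (a + b + (a + b)) x0.
set u := sin (a + a) * _ in t0 *; set v := sin (b + b) * _ in t1 *.
set w := sin (a + b + (a + b)) * _ in t2 *.
rewrite [leLHS](_ : _ = N^-1 * ((u + v + w) / 8)); last first.
  have -> : X * cos a * (X * cos b) * (X * cos (a + b)) =
      X ^+ 3 * (cos a * cos b * cos (a + b)) by ring.
  by rewrite cos_product; field; rewrite gt_eqF.
rewrite ler_pM2l ?invr_gt0//; move: t0 t1 t2.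
by rewrite !ler_norml; lra.
Qed.

Lemma integral_expr_add (a b : expr R n) :
  (forall x, ~ cube 1 x -> eval a x = 0) -> (forall x, ~ cube 1 x -> eval b x = 0) ->
  (\int[vol]_x (eval (Add a b) x)%:E =
   \int[vol]_x (eval a x)%:E + \int[vol]_x (eval b x)%:E)%E.
Proof.
move=> a0 b0; rewrite -integralD//; exact: integrable_eval.
Qed.

Lemma integral_defect :
  (\int[vol]_x (eval defect x)%:E = (1 / 4)%:E * \int[vol]_x (eval bump3 x)%:E)%E.
Proof.
have d0 i p : forall x, ~ cube 1 x -> eval (diff_expr i (osc p)) x = 0.
  by apply: diff_expr_out; exact: osc_out.
have d00 i p i' p' : forall x, ~ cube 1 x ->
    eval (Add (diff_expr i (osc p)) (diff_expr i' (osc p'))) x = 0.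
  move=> x xc; rewrite -[LHS]/(eval (diff_expr i (osc p)) x + eval (diff_expr i' (osc p')) x).
  by rewrite !d0// addr0.
transitivity ((1 / 4)%:E * \int[vol]_x (eval (Add bump3 flux) x)%:E)%E.
  rewrite -integralZl//; apply: integrable_eval => x xc.
  by rewrite -[LHS]/(eval bump3 x + eval flux x) flux_out// bump3_out// addr0.
rewrite integral_expr_add; [|exact: bump3_out|exact: flux_out].
rewrite /flux integral_expr_add; [|exact: d0|exact: d00].
rewrite integral_expr_add; [|exact: d0|exact: d0].
by rewrite !integral_diff_expr ?adde0//; exact: osc_out.
Qed.

End frequency.

(** The constants are fixed before [eps], [gam] and [N], so these can afterwards be chosen in this
    order, each depending on the previous ones. *)
Lemma integrand_average : exists C1 C2 C3 : R, [/\ 0 <= C1, 0 <= C2, 0 <= C3 &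
  forall eps gam N x, 0 <= eps -> 0 <= gam -> 1 <= N ->
  integrand e eps gam (ext_d e (@Dcompetitor R n' q N) x) + eval (defect N) x <=
  N^-1 * C1 + eps * C2 + gam * (N^-1 * C3)].
Proof.
have [C0 C00 bC] := eval_bounded (@bump_out R n).
have [Cz Cz0 zC] := @error_bound R n' q e.
have /choice[D DP] : forall i, exists C, forall x, `|eval (diff_expr i bump3) x| <= C.
  move=> i; have [C _ CP] := @eval_bounded _ _ (diff_expr i bump3)
    (diff_expr_out i bump3_out).
  by exists C.
have D0 i : 0 <= D i := le_trans (normr_ge0 _) (DP i 0).
pose C6 := \sum_i D i.
have C60 : 0 <= C6 by apply: sumr_ge0.
have C6P i x : `|eval (diff_expr i bump3) x| <= C6.
  by rewrite (le_trans (DP i x))// /C6 (bigD1 i)//= lerDl sumr_ge0.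
exists (3 * Cz * (C0 + Cz) ^+ 2 + C6), (((C0 * plane_norm R n' e + Cz) ^+ 2) ^+ 2),
  ((Cz * (1 + plane_norm R n' e)) ^+ 2); split; rewrite ?sqr_ge0//.
  by rewrite addr_ge0// mulr_ge0 ?sqr_ge0// mulr_ge0.
move=> eps gam N x eps0 gam0 N1.
have N0 : 0 < N by exact: lt_le_trans N1.
have nu01 : 0 <= N^-1 <= 1 by rewrite invr_ge0 ltW//= invf_le1.
have cosle (u : R) : `|eval bump x * cos u| <= C0.
  rewrite normrM (le_trans _ (bC x))// ler_piMr//.
  by rewrite ler_norml cos_geN1 cos_le1.
rewrite (ext_d_comp hn) ?gt_eqF//.
have h1 := integrand_le hq hn e eps0 gam0 nu01
  (cosle (eval (phase0 n' N) x)) (cosle (eval (phase1 n' N) x))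
  (cosle (eval (phase2 n' N) x)) (zC N x).
have h2 := product_average (x := x) N0 (C6P^~ x).
have nu2 : N^-1 ^+ 2 <= N^-1 by case/andP: nu01 => ? ?; rewrite expr2 ler_piMl.
have h3 := ler_wpM2l gam0 (ler_wpM2r (sqr_ge0 (Cz * (1 + plane_norm R n' e))) nu2).
rewrite [N^-1 * (_ + C6)]mulrDr.
move: (le_trans h1 (lerD (lexx _) h3)) h2.
set f := integrand _ _ _ _; set d := eval (defect N) x; set p := - (_ * _ * _).
by set s1 := N^-1 * (3 * _ * _); set s2 := eps * _; set s3 := gam * _; clear; lra.
Qed.

End averaging.

(** * Choice of the parameters and conclusion *)

Section counterexample.
Context (R : realType) (n' q : nat).
Hypotheses (hq : (0 < q)%N) (hn : (q.+3 <= n')%N).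
Local Notation n := n'.+1.
Local Notation V := 'rV[R]_n.
Local Notation vol := (lebesgue_rV R n).
Local Notation box := (@box2 R n).
Local Notation e := (erefl : (1 + q = q.+1)%N).

Lemma integrand0 (eps gam : R) : integrand (n' := n') e eps gam 0 = 0.
Proof.
have off0 : off e (0 : altform R n q.+1) = 0.
  by have := off_linear e (-1) (0 : altform R n q.+1) 0; rewrite scaler0 addr0 scaleN1r addNr.
rewrite /integrand off0 sqn0; set a := amp_r 0; have {a} -> : a = 0 by [].
by rewrite expr2 !mul0r !mulr0 oppr0 !addr0.
Qed.

(** Quasiconvexity is tested at xi = 0, where the integrand vanishes, so the integral along the
    competitor is nonnegative. Adding the integral of [defect] gives the lower bound, and the
    pointwise bound [c] gives the upper one. *)
Lemma quasiconvex_average (eps gam N c : R) : N != 0 ->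
  ext_quasiconvex (integrand (n' := n') e eps gam) ->
  (forall x : V, integrand e eps gam (ext_d e (Dcompetitor q N) x) +
    eval (defect n' N) x <= c) ->
  ((1 / 4)%:E * \int[vol]_x (eval (bump3 R n') x)%:E <= c%:E * vol box)%E.
Proof.
move=> N0 [_ _ qc] Fc.
have mbox : measurable box by apply: open_measurable_rV; exact: open_box2.
have := qc q e box 0 _ _ (@open_box2 R n) (@bounded_box2 R n) (@comp_W1_0_oo R n' q N).
rewrite integrand0 mul0e.
pose F (x : V) := integrand e eps gam (ext_d e (Dcompetitor q N) x).
have F0 (x : V) : ~ cube 1 x -> F x = 0.
  by move=> xc; rewrite /F ext_d_comp_out// integrand0.
under eq_integral do rewrite add0r.
rewrite (@integral_supp _ _ box F) => [qc0|x xb]; last first.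
  by apply: F0 => /cube1_box2.
have cF : continuous F by exact: continuous_integrand_comp.
have iF := integrable_compact_supp (@compact_cube R n 1) cF F0.
have iD := integrable_eval (@defect_out R n' N).
have iFD : vol.-integrable [set: V] (EFin \o (fun x => F x + eval (defect n' N) x)).
  by have := integrableD measurableT iF iD; apply: eq_integrable.
apply: (@le_trans _ _ (\int[vol]_x (F x + eval (defect n' N) x)%:E)%E).
  have -> : (\int[vol]_x (F x + eval (defect n' N) x)%:E =
      \int[vol]_x (F x)%:E + \int[vol]_x (eval (defect n' N) x)%:E)%E.
    by rewrite -integralD.
  by rewrite (@integral_defect R n' N) leeDr.
rewrite -(@integral_supp _ _ box) => [|x xb]; last first.
  by rewrite F0 ?defect_out ?addr0// => /cube1_box2.
rewrite -integral_cst//; apply: le_integral => //.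
- exact: integrableS iFD.
- apply: (@measurable_bounded_integrable _ _ _ vol (cst c)) => //.
    exact: vol_box2.
  by exists `|c|; split; [exact: num_real|move=> M cM x _; exact: ltW].
- by move=> x _; rewrite lee_fin; exact: Fc.
Qed.

Lemma one_convex_not_quasiconvex :
  exists f : altform R n q.+1 -> R, ext_one_convex f /\ ~ ext_quasiconvex f.
Proof.
have [C1 [C2 [C3 [C10 C20 C30 hC]]]] := @integrand_average R n' q hq hn e.
have ib := integrable_eval (@bump3_out R n').
have b0 : (0 < \int[vol]_x (eval (bump3 R n') x)%:E)%E.
  apply: integral_eval_gt0 => [x|]; first by rewrite /= !mulr_ge0// bump_ge0.
  by rewrite /= !mulr_gt0// bump0_gt0.
have := integrable_fin_num measurableT ib; move: b0.
set I := (\int[vol]_x _)%E => b0 /fineK IE.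
pose c0 := fine I; have c00 : 0 < c0 by rewrite -lte_fin IE.
have vE : (fine (vol box))%:E = vol box.
  by rewrite fineK// ge0_fin_numE// vol_box2.
pose v := fine (vol box); have v0 : 0 <= v by rewrite fine_ge0.
(* Makes the [eps] contribution at most c0 / 16; the added 1 keeps the denominator positive. *)
pose eps := c0 / (16 * (v * C2 + 1)).
have vC0 : 0 < v * C2 + 1 by rewrite ltr_wpDl// mulr_ge0.
have eps0 : 0 < eps by rewrite divr_gt0// mulr_gt0.
(* Equality in the condition of [integrand_one_convex]. *)
pose gam := 9 * (2 * q.+2%:R) ^+ 2 / (8 * eps).
have gam0 : 0 <= gam.
  by apply: divr_ge0; apply: mulr_ge0 => //; exact: ltW.
pose K := v * (C1 + gam * C3); have K0 : 0 <= K by rewrite mulr_ge0// addr_ge0// mulr_ge0.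
(* Makes the terms in 1/N at most c0 / 16 in total. The upper bound is then c0 / 8, against the
   lower bound c0 / 4. *)
pose N := 1 + 16 * K / c0.
have N1 : 1 <= N by rewrite /N lerDl; apply: divr_ge0; [exact: mulr_ge0|exact: ltW].
have N0 : 0 < N by exact: lt_le_trans N1.
exists (integrand e eps gam); split.
  apply: integrand_one_convex => //.
  by rewrite [leRHS]mulrC divfK// mulf_neq0// gt_eqF.
move=> qc.
have := quasiconvex_average (lt0r_neq0 N0) qc (fun x => hC eps gam N x (ltW eps0) gam0 N1).
rewrite -/I -IE -vE -!EFinM lee_fin -/c0 -/v => h.
have h1 : v * (eps * C2) <= c0 / 16.
  rewrite /eps [leLHS](_ : _ = c0 / 16 * (v * C2 / (v * C2 + 1))); last first.
    by field; rewrite gt_eqF.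
  by rewrite ler_piMr ?divr_ge0 ?ltW// ltr_pdivrMr// mul1r ltrDl.
have h2 : N^-1 * K <= c0 / 16.
  rewrite mulrC ler_pdivrMr// /N mulrDr mulr1.
  have -> : c0 / 16 * (16 * K / c0) = K by field; rewrite gt_eqF.
  by rewrite lerDr divr_ge0// ltW.
have E : (N^-1 * C1 + eps * C2 + gam * (N^-1 * C3)) * v = v * (eps * C2) + N^-1 * K.
  by rewrite /K; ring.
move: h; rewrite E; apply/negP; rewrite -ltNge (le_lt_trans (lerD h1 h2))//.
by clear -c00; lra.
Qed.

End counterexample.

Theorem theorem4p8 (R : realType) (n k : nat) (hk : (2 <= k <= n - 3)%N) :
  exists f : altform R n k -> R, ext_one_convex f /\ ~ ext_quasiconvex f.
Proof.
(* With k = q + 1 and [n] now the predecessor of the dimension, the bounds read 0 < q and q + 3 <=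
   n. In dimension 0 the truncated subtraction gives 0 and contradicts 2 <= k. *)
case: k n hk => [//|q] [|n] /andP[q0 qn]; first by move: qn; rewrite sub0n.
by apply: one_convex_not_quasiconvex => //; move: qn; clear; lia.
Qed.
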